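(* For $(i,j)\in\{(0,1),(0,2),(0,3),(1,2),(1,3),(2,3)\}$ let $\Lambda_n^{(i,j)}$, $n\ge1$, be the eigenvalues, in nondecreasing order and counted with multiplicity, of $$u^{(4)}(x)=\Lambda u(x),\quad x\in(0,1),\qquad u^{(i)}(0)=u^{(j)}(0)=u^{(i)}(1)=u^{(j)}(1)=0.$$ Let $$c=\sum_{n=1}^\infty\left[4\left(\pi e^{-\pi n}\left(n+\tfrac12\right)^3+\pi^3e^{-3\pi n}\left(n+\tfrac12\right)\right)+6\pi^2e^{-2\pi n}\left(n+\tfrac12\right)^2+\pi^4e^{-4\pi n}\right]\in\,]2,3[.$$ Then for any $z>0$ the following inequalities hold. \begin{itemize} \item (Biharmonic Dirichlet) $$\frac4{5\pi}z^{\frac54}-z-\frac{11\pi}6z^{\frac34}-\frac{3\pi^2}2z^{\frac12}-\frac{127\pi^3}{240}z^{\frac14}-c\le\sum_{n\ge1}(z-\Lambda_n^{(0,1)})_+\le\frac4{5\pi}z^{\frac54}-z+\frac\pi6z^{\frac34}+\frac{3\pi^2}2z^{\frac12}+\frac{\pi^3}{30}z^{\frac14}+\frac{\pi^4}8+c.$$ \item (Navier) $$\frac4{5\pi}z^{\frac54}-\frac12z-\frac\pi3z^{\frac34}\le\sum_{n\ge1}(z-\Lambda_n^{(0,2)})_+\le\frac4{5\pi}z^{\frac54}-\frac12z+\frac\pi6z^{\frac34}+\frac{\pi^2}{12}z^{\frac12}.$$ \item (Dirichlet-Neumann and Neumann-Dirichlet mixed) $\sum_{n\ge1}(z-\Lambda_n^{(0,3)})_+=\sum_{n\ge1}(z-\Lambda_n^{(1,2)})_+$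 and $$\frac4{5\pi}z^{\frac54}-\frac{11\pi}6z^{\frac34}-\frac{3\pi^2}2z^{\frac12}-\frac{127\pi^3}{240}z^{\frac14}-c\le\sum_{n\ge1}(z-\Lambda_n^{(0,3)})_+\le\frac4{5\pi}z^{\frac54}+\frac\pi6z^{\frac34}+\frac{3\pi^2}2z^{\frac12}+\frac{\pi^3}{30}z^{\frac14}+\frac{\pi^4}8+c.$$ \item (Kuttler-Sigillito) $$\frac4{5\pi}z^{\frac54}+\frac12z-\frac\pi3z^{\frac34}\le\sum_{n\ge1}(z-\Lambda_n^{(1,3)})_+\le\frac4{5\pi}z^{\frac54}+\frac12z+\frac\pi6z^{\frac34}+\frac{\pi^2}{12}z^{\frac12}.$$ \item (Biharmonic Neumann) $$\frac4{5\pi}z^{\frac54}+z-\frac{11\pi}6z^{\frac34}-\frac{3\pi^2}2z^{\frac12}-\frac{127\pi^3}{240}z^{\frac14}-c\le\sum_{n\ge1}(z-\Lambda_n^{(2,3)})_+\le\frac4{5\pi}z^{\frac54}+z+\frac\pi6z^{\frac34}+\frac{3\pi^2}2z^{\frac12}+\frac{\pi^3}{30}z^{\frac14}+\frac{\pi^4}8+c.$$ \end{itemize}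
   Context: $x_+=\max\{x,0\}$ and $u^{(i)}$ denotes the $i$-th derivative of $u$ (with $u^{(0)}=u$). For each pair $(i,j)$ the spectrum is a sequence of nonnegative eigenvalues diverging to infinity; all positive eigenvalues are simple. *)

(* Defs.v *)
From Stdlib Require Import Reals List.
From Coquelicot Require Import Coquelicot.
Import ListNotations.
Open Scope R_scope.

(* C^4([0,1]) is represented by functions on the whole line, i.e. by C^4
   extensions; two such functions are identified when they agree on [0,1], and
   [has_dim] below respects this identification. *)
Definition C4 (u : R -> R) : Prop :=
  (forall (k : nat) (x : R), (k <= 4)%nat -> ex_derive_n u k x) /\
  (forall x : R, continuous (Derive_n u 4) x).

Definition eigenspace (i j : nat) (lam : R) (u : R -> R) : Prop :=
  C4 u /\
  (forall x : R, 0 < x < 1 -> Derive_n u 4 x = lam * u x) /\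
  Derive_n u i 0 = 0 /\ Derive_n u j 0 = 0 /\
  Derive_n u i 1 = 0 /\ Derive_n u j 1 = 0.

(* Bases are indexed by 1, ..., m; the sum is empty for m = 0. *)
Definition lin_comb (m : nat) (a : nat -> R) (b : nat -> R -> R) (x : R) : R :=
  sum_n_m (fun k => a k * b k x) 1 m.

Definition has_dim (E : (R -> R) -> Prop) (m : nat) : Prop :=
  exists b : nat -> R -> R,
    (forall k : nat, (1 <= k <= m)%nat -> E (b k)) /\
    (forall a : nat -> R,
        (forall x : R, 0 <= x <= 1 -> lin_comb m a b x = 0) ->
        forall k : nat, (1 <= k <= m)%nat -> a k = 0) /\
    (forall u : R -> R, E u ->
        exists a : nat -> R,
          forall x : R, 0 <= x <= 1 -> u x = lin_comb m a b x).

(* Sequences are indexed by n >= 1; the value at 0 is ignored.  Every real lam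
   occurs as often as the dimension of its eigenspace, so numbers that are not
   eigenvalues (dimension 0) do not occur. *)
Definition is_eigenvalue_seq (i j : nat) (Lam : nat -> R) : Prop :=
  (forall m n : nat, (1 <= m <= n)%nat -> Lam m <= Lam n) /\
  (forall lam : R,
      exists l : list nat,
        NoDup l /\
        (forall n : nat, In n l <-> (1 <= n)%nat /\ Lam n = lam) /\
        has_dim (eigenspace i j lam) (length l)).

Definition boundary_pairs : list (nat * nat) :=
  [(0, 1); (0, 2); (0, 3); (1, 2); (1, 3); (2, 3)]%nat.

Definition pos_part (x : R) : R := Rmax x 0.

(* [Series] sums from 0, so summation over n >= 1 is shifted by [S]; it is a
   total function, hence convergence has to be asserted separately. *)
Definition riesz_term (Lam : nat -> R) (z : R) (n : nat) : R :=
  pos_part (z - Lam (S n)).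

Definition riesz_mean (Lam : nat -> R) (z : R) : R :=
  Series (riesz_term Lam z).

Definition c_term (n : nat) : R :=
  4 * (PI * exp (- PI * INR n) * (INR n + 1 / 2) ^ 3
       + PI ^ 3 * exp (- 3 * PI * INR n) * (INR n + 1 / 2))
  + 6 * PI ^ 2 * exp (- 2 * PI * INR n) * (INR n + 1 / 2) ^ 2
  + PI ^ 4 * exp (- 4 * PI * INR n).

Definition c_const : R := Series (fun n => c_term (S n)).

(* Main.v *)
Require Import Defs.
From Stdlib Require Import Reals ZArith List Lra Lia ClassicalEpsilon.
From Coquelicot Require Import Coquelicot.
Open Scope R_scope.

(** The eigenvalues are computed, and the Riesz means become sums over integers or
    half-integers, which are polynomials in the endpoint.

    On [0,1] the solutions of [u'''' = k^4 u] are the combinations of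
    [cos (k x)], [sin (k x)], [cosh (k x)], [sinh (k x)] ([solve_beam]), those of
    [u'''' = 0] are the cubic polynomials ([solve_cubic]), and negative values are
    excluded by a quantity that is monotone on [0,1] and vanishes at both ends
    ([negative_dim]).  The boundary conditions are then linear equations: the pairs
    (0,2) and (1,3) lead to [sin k = 0], the four other pairs to
    [cos k cosh k = 1], always with one-dimensional eigenspaces, and the kernel has
    dimension 0 for (0,1) and (0,2), 1 for (0,3), (1,2) and (1,3), 2 for (2,3).
    As multiplicities determine a nondecreasing sequence
    ([is_eigenvalue_seq_unique]), each sequence of eigenvalues consists of [p] zeros,
    where [p] is the dimension of the kernel, followed by the fourth powers of
    the positive roots.  Hence its Riesz mean is [p z] plus the Riesz mean of the
    fourth powers ([riesz_shift]).

    For [sin k = 0], put [z = (PI T)^4] and let [n] be the integer part of [T].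
    Faulhaber's formula evaluates the sum, and its difference from
    [4/5 T^5 - T^4/2] is a combination of Bernoulli polynomials in [T - n],
    whose extreme values give the two bounds ([integer_sum_lower],
    [integer_sum_upper]).

    For [cos k cosh k = 1], the angle [gd k = atan (sinh k)] has cosine
    [1 / cosh k], so that [k = 2 pi m + gd k] or [k = 2 pi m - gd k].  The
    functions [k - gd k] and [k + gd k] are increasing, which gives one root in each
    interval from [n PI] to [(n + 1) PI], [n >= 1], and no other positive root; its
    distance from the midpoint is at most [1 / sinh (n PI)].  The fourth powers of
    roots and midpoints therefore differ by at most [5/2 PI^4] in total
    ([riesz_frequency_close]).  The sum over the midpoints is again explicit
    ([midpoint_sum_bounds]), and for [T >= 3/2] the terms of order [T^2] and [T^3]
    in the claim absorb this error; for [T <= 3/2] the sum is empty.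

    The [n]-th term of the constant [c] is
    [(n + 1/2 + PI exp (- PI n))^4 - (n + 1/2)^4]; its first two terms and a
    geometric tail give [2 < c < 3]. *)

(** * Dimension is well defined *)

Lemma lin_comb_S (m : nat) (a : nat -> R) (b : nat -> R -> R) (x : R) :
  lin_comb (S m) a b x = lin_comb m a b x + a (S m) * b (S m) x.
Proof. unfold lin_comb. rewrite sum_n_Sm by lia. reflexivity. Qed.

Lemma lin_comb_0 (a : nat -> R) (b : nat -> R -> R) (x : R) :
  lin_comb 0 a b x = 0.
Proof. unfold lin_comb. rewrite sum_n_m_zero by lia. reflexivity. Qed.

Lemma lin_comb_ext (m : nat) (a a' : nat -> R) (b b' : nat -> R -> R) (x : R) :
  (forall k, (1 <= k <= m)%nat -> a k * b k x = a' k * b' k x) ->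
  lin_comb m a b x = lin_comb m a' b' x.
Proof. intros H. apply sum_n_m_ext_loc. exact H. Qed.

Lemma lin_comb_eq_0 (m : nat) (a : nat -> R) (b : nat -> R -> R) (x : R) :
  (forall k, (1 <= k <= m)%nat -> a k * b k x = 0) -> lin_comb m a b x = 0.
Proof.
  induction m as [|m IH]; intros H.
  - apply lin_comb_0.
  - rewrite lin_comb_S, IH, H by (auto with arith || (intros; apply H; lia)). ring.
Qed.

Lemma lin_comb_lin_comb (p m : nat) (a : nat -> R) (al : nat -> nat -> R)
    (b : nat -> R -> R) (x : R) :
  lin_comb p a (fun k => lin_comb m (al k) b) x =
  lin_comb m (fun i => lin_comb p a (fun k _ => al k i) 0) b x.
Proof.
  induction p as [|p IH].
  - rewrite lin_comb_0. symmetry. apply lin_comb_eq_0. intros k _.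
    rewrite lin_comb_0. ring.
  - rewrite lin_comb_S, IH. clear IH.
    induction m as [|m IH].
    + rewrite !lin_comb_0. ring.
    + rewrite !lin_comb_S, <- IH. ring.
Qed.

(** Gaussian elimination on the coordinates: the last vector serves as pivot,
    and the coordinate [i0] where it does not vanish is skipped in the recursive
    call, so that only the coordinates, over which nothing is summed, have to be
    renumbered. *)
Lemma dependent_vectors (m : nat) (v : nat -> nat -> R) :
  exists a : nat -> R,
    (exists k, (1 <= k <= S m)%nat /\ a k <> 0) /\
    (forall i, (i < m)%nat -> lin_comb (S m) a (fun k _ => v k i) 0 = 0).
Proof.
  revert v. induction m as [|m IH]; intros v.
  - exists (fun _ => 1). split; [exists 1%nat; split; [lia | lra] | lia].
  - destruct (classic (exists i0, (i0 < S m)%nat /\ v (S (S m)) i0 <> 0))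
      as [[i0 [Hi0 Hv]] | Hno].
    + set (skip := fun i => if Nat.ltb i i0 then i else S i).
      set (r := fun k => v k i0 / v (S (S m)) i0).
      destruct (IH (fun k i => v k (skip i) - r k * v (S (S m)) (skip i)))
        as [a [[k0 [Hk0 Hak0]] Ha]].
      set (s := lin_comb (S m) a (fun k _ => r k) 0).
      exists (fun k => if Nat.eqb k (S (S m)) then - s else a k).
      split.
      { exists k0. split; [lia|].
        replace (Nat.eqb k0 (S (S m))) with false
          by (symmetry; apply Nat.eqb_neq; lia). exact Hak0. }
      assert (Hred : forall i, lin_comb (S (S m))
          (fun k => if Nat.eqb k (S (S m)) then - s else a k) (fun k _ => v k i) 0
          = lin_comb (S m) a (fun k _ => v k i - r k * v (S (S m)) i) 0).
      { intros i. rewrite lin_comb_S, Nat.eqb_refl.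
        rewrite (lin_comb_ext _ _ a _ (fun k _ => v k i)).
        2:{ intros k Hk. replace (Nat.eqb k (S (S m))) with false
              by (symmetry; apply Nat.eqb_neq; lia). reflexivity. }
        unfold s. clearbody r. generalize (v (S (S m)) i) as t. intros t.
        generalize (S m) as p. induction p as [|p IHp].
        - rewrite !lin_comb_0. ring.
        - rewrite !lin_comb_S. rewrite <- IHp. ring. }
      intros i Hi. rewrite Hred.
      destruct (Nat.lt_trichotomy i i0) as [Hlt | [Heq | Hgt]].
      * refine (eq_trans _ (Ha i _)); [|lia]. apply lin_comb_ext. intros k _. unfold skip.
        replace (Nat.ltb i i0) with true by (symmetry; apply Nat.ltb_lt; lia).
        reflexivity.
      * apply lin_comb_eq_0. intros k _. subst i. unfold r. field. exact Hv.
      * refine (eq_trans _ (Ha (pred i) _)); [|lia]. apply lin_comb_ext. intros k _.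
        unfold skip. replace (Nat.ltb (pred i) i0) with false
          by (symmetry; apply Nat.ltb_ge; lia).
        replace (S (pred i)) with i by lia. reflexivity.
    + exists (fun k => if Nat.eqb k (S (S m)) then 1 else 0). split.
      { exists (S (S m)). rewrite Nat.eqb_refl. split; [lia | lra]. }
      intros i Hi. apply lin_comb_eq_0. intros k Hk.
      destruct (Nat.eqb_spec k (S (S m))) as [-> | _]; [|ring].
      destruct (Req_dec (v (S (S m)) i) 0) as [-> | Hne]; [ring|].
      exfalso. apply Hno. exists i. auto.
Qed.

Lemma has_dim_le (E : (R -> R) -> Prop) (m m' : nat) :
  has_dim E m -> has_dim E m' -> (m' <= m)%nat.
Proof.
  intros [b [_ [_ Hspan]]] [b' [Hin [Hfree _]]].
  destruct (Nat.le_gt_cases m' m) as [|Hlt]; [assumption|exfalso].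
  set (al := fun k => epsilon (inhabits (fun _ : nat => 0))
    (fun a => forall x, 0 <= x <= 1 -> b' k x = lin_comb m a b x)).
  assert (Hal : forall k, (1 <= k <= m')%nat ->
            forall x, 0 <= x <= 1 -> b' k x = lin_comb m (al k) b x).
  { intros k Hk. apply (epsilon_spec (inhabits (fun _ : nat => 0))
      (fun a => forall x, 0 <= x <= 1 -> b' k x = lin_comb m a b x)).
    apply Hspan, Hin, Hk. }
  destruct (dependent_vectors m (fun k i => al k (S i)))
    as [a [[k0 [Hk0 Hak0]] Ha]].
  set (a' := fun k => if Nat.leb k (S m) then a k else 0).
  apply Hak0. replace (a k0) with (a' k0)
    by (unfold a'; rewrite (proj2 (Nat.leb_le _ _)) by lia; reflexivity).
  apply Hfree; [|lia]. intros x Hx.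
  assert (Hcut : forall d, lin_comb (S m + d) a' b' x = lin_comb (S m) a b' x).
  { induction d as [|d IHd].
    - rewrite Nat.add_0_r. apply lin_comb_ext. intros k Hk. unfold a'.
      rewrite (proj2 (Nat.leb_le _ _)) by lia. reflexivity.
    - rewrite Nat.add_succ_r, lin_comb_S, IHd. unfold a' at 1.
      rewrite (proj2 (Nat.leb_gt _ _)) by lia. ring. }
  replace m' with (S m + (m' - S m))%nat by lia. rewrite Hcut.
  rewrite (lin_comb_ext _ a a b' (fun k => lin_comb m (al k) b)).
  2:{ intros k Hk. rewrite Hal by (assumption || lia). reflexivity. }
  rewrite lin_comb_lin_comb. apply lin_comb_eq_0. intros k Hk.
  destruct k as [|i]; [lia|]. rewrite Ha by lia. ring.
Qed.

Lemma has_dim_unique (E : (R -> R) -> Prop) (m m' : nat) :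
  has_dim E m -> has_dim E m' -> m = m'.
Proof.
  intros H H'. apply Nat.le_antisymm; eapply has_dim_le; eassumption.
Qed.

Lemma has_dim_0 (E : (R -> R) -> Prop) :
  (forall u, E u -> forall x, 0 <= x <= 1 -> u x = 0) -> has_dim E 0.
Proof.
  intros H. exists (fun _ _ => 0). split; [lia|]. split; [lia|].
  intros u Hu. exists (fun _ => 0). intros x Hx. rewrite lin_comb_0. auto.
Qed.

Lemma has_dim_1 (E : (R -> R) -> Prop) (b : R -> R) (x0 : R) :
  E b -> 0 <= x0 <= 1 -> b x0 <> 0 ->
  (forall u, E u -> exists t, forall x, 0 <= x <= 1 -> u x = t * b x) ->
  has_dim E 1.
Proof.
  intros Eb Hx0 Hb H. exists (fun _ => b). split; [auto|]. split.
  - intros a Ha k Hk. replace k with 1%nat by lia.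
    generalize (Ha x0 Hx0). rewrite lin_comb_S, lin_comb_0, Rplus_0_l. intros E0.
    apply Rmult_integral in E0. tauto.
  - intros u Hu. destruct (H u Hu) as [t Ht]. exists (fun _ => t). intros x Hx.
    rewrite lin_comb_S, lin_comb_0, Ht by assumption. ring.
Qed.

(** * Multiplicities determine the sequence of eigenvalues *)

Lemma multiplicities_no_lt (L M : nat -> R) (n : nat) :
  (forall p q, (1 <= p <= q)%nat -> M p <= M q) ->
  (forall lam, exists l l' : list nat,
      NoDup l /\ NoDup l' /\ length l = length l' /\
      (forall k, In k l <-> (1 <= k)%nat /\ L k = lam) /\
      (forall k, In k l' <-> (1 <= k)%nat /\ M k = lam)) ->
  (1 <= n)%nat -> (forall k, (1 <= k < n)%nat -> L k = M k) -> ~ L n < M n.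
Proof.
  intros HM Hmult Hn Heq Hlt.
  destruct (Hmult (L n)) as [l [l' [Hl [Hl' [Hlen [Hin Hin']]]]]].
  (* Every index where [M] takes the value [L n] precedes [n], so it is also an
     index for [L]; but [n] is one more index for [L]. *)
  assert (Hsub : forall k, In k l' -> (1 <= k < n)%nat /\ In k l).
  { intros k Hk. apply Hin' in Hk. destruct Hk as [Hk HMk].
    assert (k < n)%nat.
    { destruct (Nat.lt_ge_cases k n) as [|Hge]; [assumption|exfalso].
      assert (M n <= M k) by (apply HM; lia). lra. }
    split; [lia|]. apply Hin. split; [assumption|]. rewrite Heq by lia. exact HMk. }
  assert (Hle : (length (n :: l') <= length l)%nat).
  { apply NoDup_incl_length.
    - constructor; [|assumption]. intros Hnl. apply Hsub in Hnl. lia.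
    - intros k [<- | Hk]; [apply Hin; auto | apply Hsub; assumption]. }
  simpl in Hle. lia.
Qed.

(** At the first index where two nondecreasing sequences differ, the smaller of
    the two values has been taken more often by its own sequence. *)
Lemma multiplicities_determine (L M : nat -> R) :
  (forall p q, (1 <= p <= q)%nat -> L p <= L q) ->
  (forall p q, (1 <= p <= q)%nat -> M p <= M q) ->
  (forall lam, exists l l' : list nat,
      NoDup l /\ NoDup l' /\ length l = length l' /\
      (forall k, In k l <-> (1 <= k)%nat /\ L k = lam) /\
      (forall k, In k l' <-> (1 <= k)%nat /\ M k = lam)) ->
  forall n, (1 <= n)%nat -> L n = M n.
Proof.
  intros HL HM Hmult n. induction n as [n IH] using lt_wf_ind. intros Hn.
  destruct (Rtotal_order (L n) (M n)) as [Hlt | [Heq | Hgt]]; [exfalso | assumption | exfalso].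
  - revert Hlt. apply multiplicities_no_lt; auto. intros k Hk. apply IH; lia.
  - revert Hgt. apply multiplicities_no_lt; auto.
    + intros lam. destruct (Hmult lam) as [l [l' H]]. exists l', l. intuition.
    + intros k Hk. symmetry. apply IH; lia.
Qed.

Lemma is_eigenvalue_seq_unique (i j : nat) (L M : nat -> R) :
  is_eigenvalue_seq i j L -> is_eigenvalue_seq i j M ->
  forall n, (1 <= n)%nat -> L n = M n.
Proof.
  intros [HL ML] [HM MM]. apply multiplicities_determine; auto.
  intros lam. destruct (ML lam) as [l [Hl [Hin Hd]]].
  destruct (MM lam) as [l' [Hl' [Hin' Hd']]].
  exists l, l'. refine (conj Hl (conj Hl' (conj _ (conj Hin Hin')))).
  eapply has_dim_unique; eassumption.
Qed.

(** The six spectra have this shape: fourth powers of an increasing sequence [k]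
    that starts at [k 0 = 0], where the value 0 is taken [p] times.  Truncated
    subtraction repeats [k 0] at the [p] indices [1, ..., p]. *)
Definition shifted_fourth_powers (k : nat -> R) (p n : nat) : R := k (n - p)%nat ^ 4.

Lemma pow4_lt (x y : R) : 0 <= x -> x < y -> x ^ 4 < y ^ 4.
Proof.
  intros Hx Hxy. assert (x * x < y * y) by nra.
  replace (x ^ 4) with ((x * x) * (x * x)) by ring.
  replace (y ^ 4) with ((y * y) * (y * y)) by ring. nra.
Qed.

Lemma pow4_inj (x y : R) : 0 <= x -> 0 <= y -> x ^ 4 = y ^ 4 -> x = y.
Proof.
  intros Hx Hy H. destruct (Rtotal_order x y) as [Hlt | [Heq | Hgt]]; auto.
  - pose proof (pow4_lt x y Hx Hlt). lra.
  - pose proof (pow4_lt y x Hy Hgt). lra.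
Qed.

Lemma pow4_root (x : R) : 0 < x -> exists k, 0 < k /\ x = k ^ 4.
Proof.
  intros Hx. exists (sqrt (sqrt x)). split.
  - apply sqrt_lt_R0, sqrt_lt_R0, Hx.
  - replace (sqrt (sqrt x) ^ 4) with ((sqrt (sqrt x) * sqrt (sqrt x)) * (sqrt (sqrt x) * sqrt (sqrt x))) by ring.
    rewrite sqrt_sqrt by apply sqrt_pos. rewrite sqrt_sqrt by lra. reflexivity.
Qed.

Lemma shifted_fourth_powers_spectrum (i j : nat) (k : nat -> R) (p : nat) :
  k 0%nat = 0 -> (forall m n, (m < n)%nat -> k m < k n) ->
  (forall lam, lam < 0 -> has_dim (eigenspace i j lam) 0) ->
  has_dim (eigenspace i j 0) p ->
  (forall m, (1 <= m)%nat -> has_dim (eigenspace i j (k m ^ 4)) 1) ->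
  (forall x, 0 < x -> (forall m, (1 <= m)%nat -> x <> k m) ->
     has_dim (eigenspace i j (x ^ 4)) 0) ->
  is_eigenvalue_seq i j (shifted_fourth_powers k p).
Proof.
  intros k0 kincr Hneg H0 Hpos Hno.
  assert (kpos : forall m, (1 <= m)%nat -> 0 < k m)
    by (intros m Hm; rewrite <- k0; apply kincr; lia).
  assert (kge : forall m, 0 <= k m)
    by (intros [|m]; [lra | apply Rlt_le, kpos; lia]).
  split.
  - intros m n Hmn. unfold shifted_fourth_powers.
    destruct (Nat.lt_ge_cases (m - p) (n - p)) as [Hlt | Hge].
    + apply Rlt_le, pow4_lt; auto.
    + replace (n - p)%nat with (m - p)%nat by lia. lra.
  - intros lam. destruct (Rtotal_order lam 0) as [Hlt | [-> | Hgt]].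
    + exists nil. repeat split; try constructor; try apply Hneg; auto.
      * contradiction.
      * contradiction.
      * intros [_ E]. unfold shifted_fourth_powers in E.
        pose proof (pow_le _ 4 (kge (n - p)%nat)). lra.
    + exists (seq 1 p). repeat split.
      * apply seq_NoDup.
      * apply in_seq in H. lia.
      * apply in_seq in H. unfold shifted_fourth_powers.
        replace (n - p)%nat with 0%nat by lia. rewrite k0. ring.
      * intros [Hn E]. apply in_seq. split; [lia|].
        destruct (Nat.lt_ge_cases n (1 + p)) as [|Hge]; [assumption|exfalso].
        unfold shifted_fourth_powers in E.
        assert (0 < k (n - p)%nat) by (apply kpos; lia).
        pose proof (pow_lt _ 4 H). lra.
      * rewrite length_seq. exact H0.
    + destruct (pow4_root lam Hgt) as [x [Hx ->]].
      destruct (classic (exists m, (1 <= m)%nat /\ x = k m)) as [[m [Hm ->]] | Hnone].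
      * exists ((m + p)%nat :: nil). repeat split.
        -- repeat constructor. intros [].
        -- destruct H as [<- | []]. lia.
        -- destruct H as [<- | []]. unfold shifted_fourth_powers.
           replace (m + p - p)%nat with m by lia. reflexivity.
        -- intros [Hn E]. left. unfold shifted_fourth_powers in E.
           apply pow4_inj in E; [|auto|auto].
           destruct (Nat.lt_trichotomy (n - p) m) as [Hlt | [Heq | Hgt']].
           ++ apply kincr in Hlt. lra.
           ++ lia.
           ++ apply kincr in Hgt'. lra.
        -- apply Hpos, Hm.
      * exists nil. repeat split; try constructor.
        -- contradiction.
        -- contradiction.
        -- intros [Hn E]. exfalso. unfold shifted_fourth_powers in E.
           apply pow4_inj in E; [|auto|lra].
           destruct (n - p)%nat as [|q] eqn:Hq; [lra|].
           apply Hnone. exists (S q). split; [lia | auto].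
        -- apply Hno; auto. intros m Hm E. apply Hnone. exists m. auto.
Qed.

(** * Solutions of the differential equation *)

Lemma is_derive_cosh (x : R) : is_derive cosh x (sinh x).
Proof. apply is_derive_Reals, derivable_pt_lim_cosh. Qed.

Lemma is_derive_sinh (x : R) : is_derive sinh x (cosh x).
Proof. apply is_derive_Reals, derivable_pt_lim_sinh. Qed.

Lemma cosh2_sinh2 (x : R) : cosh x * cosh x - sinh x * sinh x = 1.
Proof.
  unfold cosh, sinh. assert (H : exp x * exp (- x) = 1)
    by (rewrite <- exp_plus, Rplus_opp_r; apply exp_0). nra.
Qed.

Lemma cos2_sin2 (x : R) : cos x * cos x + sin x * sin x = 1.
Proof. pose proof (sin2_cos2 x). unfold Rsqr in H. lra. Qed.

Lemma mean_value (f df : R -> R) (a b : R) :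
  (forall x, is_derive f x (df x)) -> a < b ->
  exists c, a < c < b /\ f b - f a = df c * (b - a).
Proof.
  intros Hf Hab.
  destruct (MVT_cor2 f df a b Hab) as [c [Hc1 Hc2]].
  - intros c _. apply is_derive_Reals, Hf.
  - exists c. auto.
Qed.

Lemma constant_of_derive_0 (f df : R -> R) :
  (forall x, is_derive f x (df x)) -> (forall x, 0 < x < 1 -> df x = 0) ->
  forall x, 0 <= x <= 1 -> f x = f 0.
Proof.
  intros Hf H0 x Hx. destruct (Req_dec x 0) as [-> | Hne]; [reflexivity|].
  destruct (mean_value f df 0 x Hf) as [c [Hc E]]; [lra|].
  rewrite H0 in E by lra. lra.
Qed.

Lemma derive_0_of_constant (f df : R -> R) (l : R) :
  (forall x, is_derive f x (df x)) -> (forall x, 0 < x < 1 -> f x = l) ->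
  forall x, 0 < x < 1 -> df x = 0.
Proof.
  intros Hf Hcst x Hx. rewrite <- (is_derive_unique f x _ (Hf x)).
  apply is_derive_unique. apply (is_derive_ext_loc (fun _ => l)).
  - assert (Hd : 0 < Rmin x (1 - x)) by (apply Rmin_pos; lra).
    exists (mkposreal _ Hd). intros y Hy. symmetry. apply Hcst.
    unfold ball in Hy; simpl in Hy; unfold AbsRing_ball, abs, minus, plus, opp in Hy; simpl in Hy.
    pose proof (Rmin_l x (1 - x)). pose proof (Rmin_r x (1 - x)).
    apply Rabs_def2 in Hy. lra.
  - apply (is_derive_const l x).
Qed.

(** A monotone function with equal end values is constant. *)
Lemma derive_0_of_monotone (f df : R -> R) :
  (forall x, is_derive f x (df x)) -> (forall x, 0 < x < 1 -> 0 <= df x) ->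
  f 0 = f 1 -> forall x, 0 < x < 1 -> df x = 0.
Proof.
  intros Hf Hpos H01.
  assert (Hle : forall a b, 0 <= a -> a <= b -> b <= 1 -> f a <= f b).
  { intros a b Ha Hab Hb. destruct (Req_dec a b) as [-> | Hne]; [lra|].
    destruct (mean_value f df a b Hf) as [c [Hc E]]; [lra|].
    assert (0 <= df c) by (apply Hpos; lra). nra. }
  assert (Hcst : forall x, 0 < x < 1 -> f x = f 0).
  { intros x Hx. apply Rle_antisym.
    - rewrite H01. apply Hle; lra.
    - apply Hle; lra. }
  apply (derive_0_of_constant f df (f 0)); assumption.
Qed.

Lemma C4_is_derive (u : R -> R) (n : nat) (x : R) :
  C4 u -> (n <= 3)%nat -> is_derive (Derive_n u n) x (Derive_n u (S n) x).
Proof.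
  intros [Hu _] Hn. simpl. apply Derive_correct, (Hu (S n) x). lia.
Qed.

(** The successive derivatives of an explicit solution are given in closed form;
    such a chain identifies them with the iterated derivatives. *)
Lemma derivative_chain (f : nat -> R -> R) :
  (forall n x, is_derive (f n) x (f (S n) x)) ->
  C4 (f 0%nat) /\ forall n x, Derive_n (f 0%nat) n x = f n x.
Proof.
  intros Hf.
  assert (H : forall n x, Derive_n (f 0%nat) n x = f n x).
  { induction n as [|n IH]; intros x; [reflexivity|]. simpl.
    rewrite (Derive_ext _ (f n)) by exact IH. apply is_derive_unique, Hf. }
  assert (Hd : forall n x, is_derive (Derive_n (f 0%nat) n) x (f (S n) x)).
  { intros n x. apply (is_derive_ext (f n)); [intros t; symmetry; apply H | apply Hf]. }
  split; [split|exact H].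
  - intros [|k] x _; [exact I|]. exists (f (S k) x). apply Hd.
  - intros x. apply @ex_derive_continuous. exists (f 5%nat x). apply Hd.
Qed.

(** Both quantities [w cos (k x) - w' sin (k x) / k] and
    [w sin (k x) + w' cos (k x) / k] are conserved, and [w], [w'] are recovered
    from them by a rotation. *)
Lemma solve_trigonometric (k : R) (w w1 w2 : R -> R) :
  0 < k -> (forall x, is_derive w x (w1 x)) -> (forall x, is_derive w1 x (w2 x)) ->
  (forall x, 0 < x < 1 -> w2 x = - k ^ 2 * w x) ->
  exists A B, forall x, 0 <= x <= 1 ->
    w x = A * cos (k * x) + B * sin (k * x) /\
    w1 x = k * (- A * sin (k * x) + B * cos (k * x)).
Proof.
  intros Hk Hw Hw1 Hw2.
  assert (HP : forall x, 0 <= x <= 1 ->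
    w x * cos (k * x) - w1 x * sin (k * x) / k = w 0 * cos (k * 0) - w1 0 * sin (k * 0) / k).
  { apply (constant_of_derive_0 (fun x => w x * cos (k * x) - w1 x * sin (k * x) / k)
             (fun x => - (k ^ 2 * w x + w2 x) * sin (k * x) / k)).
    - intros x. auto_derive.
      + repeat split; eexists; [apply Hw | apply Hw1].
      + rewrite (is_derive_unique (fun y : R => w y) _ _ (Hw x)), (is_derive_unique (fun y : R => w1 y) _ _ (Hw1 x)).
        field. lra.
    - intros x Hx. rewrite Hw2 by assumption. field. lra. }
  assert (HQ : forall x, 0 <= x <= 1 ->
    w x * sin (k * x) + w1 x * cos (k * x) / k = w 0 * sin (k * 0) + w1 0 * cos (k * 0) / k).
  { apply (constant_of_derive_0 (fun x => w x * sin (k * x) + w1 x * cos (k * x) / k)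
             (fun x => (k ^ 2 * w x + w2 x) * cos (k * x) / k)).
    - intros x. auto_derive.
      + repeat split; eexists; [apply Hw | apply Hw1].
      + rewrite (is_derive_unique (fun y : R => w y) _ _ (Hw x)), (is_derive_unique (fun y : R => w1 y) _ _ (Hw1 x)).
        field. lra.
    - intros x Hx. rewrite Hw2 by assumption. field. lra. }
  exists (w 0 * cos (k * 0) - w1 0 * sin (k * 0) / k), (w 0 * sin (k * 0) + w1 0 * cos (k * 0) / k).
  intros x Hx. rewrite <- (HP x Hx), <- (HQ x Hx).
  pose proof (cos2_sin2 (k * x)) as E. split.
  - transitivity (w x * (cos (k * x) * cos (k * x) + sin (k * x) * sin (k * x)));
      [rewrite E; ring | field; lra].
  - transitivity (w1 x * (cos (k * x) * cos (k * x) + sin (k * x) * sin (k * x)));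
      [rewrite E; ring | field; lra].
Qed.

(** As for [solve_trigonometric], with a hyperbolic rotation. *)
Lemma solve_hyperbolic (k : R) (v v1 v2 : R -> R) :
  0 < k -> (forall x, is_derive v x (v1 x)) -> (forall x, is_derive v1 x (v2 x)) ->
  (forall x, 0 < x < 1 -> v2 x = k ^ 2 * v x) ->
  exists A B, forall x, 0 <= x <= 1 ->
    v x = A * cosh (k * x) + B * sinh (k * x) /\
    v1 x = k * (A * sinh (k * x) + B * cosh (k * x)).
Proof.
  intros Hk Hv Hv1 Hv2.
  assert (dch : forall x, is_derive (fun y => cosh (k * y)) x (k * sinh (k * x))).
  { intros x. apply (is_derive_comp cosh (fun y => k * y)); [apply is_derive_cosh|].
    auto_derive; auto. ring. }
  assert (dsh : forall x, is_derive (fun y => sinh (k * y)) x (k * cosh (k * x))).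
  { intros x. apply (is_derive_comp sinh (fun y => k * y)); [apply is_derive_sinh|].
    auto_derive; auto. ring. }
  set (ch := fun y => cosh (k * y)) in *. set (sh := fun y => sinh (k * y)) in *.
  assert (HP : forall x, 0 <= x <= 1 ->
    v x * ch x - v1 x * sh x / k = v 0 * ch 0 - v1 0 * sh 0 / k).
  { apply (constant_of_derive_0 (fun x => v x * ch x - v1 x * sh x / k)
             (fun x => (k ^ 2 * v x - v2 x) * sh x / k)).
    - intros x. auto_derive.
      + repeat split; eexists; [apply Hv | apply dch | apply Hv1 | apply dsh].
      + rewrite (is_derive_unique (fun y : R => v y) _ _ (Hv x)), (is_derive_unique (fun y : R => v1 y) _ _ (Hv1 x)).
        rewrite (is_derive_unique (fun y : R => ch y) _ _ (dch x)), (is_derive_unique (fun y : R => sh y) _ _ (dsh x)).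
        fold (ch x) (sh x). field. lra.
    - intros x Hx. rewrite Hv2 by assumption. field. lra. }
  assert (HQ : forall x, 0 <= x <= 1 ->
    v1 x * ch x / k - v x * sh x = v1 0 * ch 0 / k - v 0 * sh 0).
  { apply (constant_of_derive_0 (fun x => v1 x * ch x / k - v x * sh x)
             (fun x => (v2 x - k ^ 2 * v x) * ch x / k)).
    - intros x. auto_derive.
      + repeat split; eexists; [apply Hv1 | apply dch | apply Hv | apply dsh].
      + rewrite (is_derive_unique (fun y : R => v y) _ _ (Hv x)), (is_derive_unique (fun y : R => v1 y) _ _ (Hv1 x)).
        rewrite (is_derive_unique (fun y : R => ch y) _ _ (dch x)), (is_derive_unique (fun y : R => sh y) _ _ (dsh x)).
        fold (ch x) (sh x). field. lra.
    - intros x Hx. rewrite Hv2 by assumption. field. lra. }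
  exists (v 0 * ch 0 - v1 0 * sh 0 / k), (v1 0 * ch 0 / k - v 0 * sh 0).
  intros x Hx. rewrite <- (HP x Hx), <- (HQ x Hx).
  pose proof (cosh2_sinh2 (k * x)) as E. fold (ch x) (sh x) in E |- *. split.
  - transitivity (v x * (ch x * ch x - sh x * sh x)); [rewrite E; ring | field; lra].
  - transitivity (v1 x * (ch x * ch x - sh x * sh x)); [rewrite E; ring | field; lra].
Qed.

(** The general solution of [u'''' = k^4 u]; differentiation permutes its
    coefficients. *)
Definition beam (k A B C D x : R) : R :=
  A * cos (k * x) + B * sin (k * x) + C * cosh (k * x) + D * sinh (k * x).

Fixpoint beam_derivative (k A B C D : R) (n : nat) : R -> R :=
  match n with
  | 0%nat => beam k A B C D
  | S m => beam_derivative k (k * B) (- k * A) (k * D) (k * C) m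
  end.

Lemma beam_is_derive (k A B C D x : R) :
  is_derive (beam k A B C D) x (beam k (k * B) (- k * A) (k * D) (k * C) x).
Proof.
  assert (dch : is_derive (fun y => cosh (k * y)) x (k * sinh (k * x))).
  { apply (is_derive_comp cosh (fun y => k * y)); [apply is_derive_cosh|].
    auto_derive; auto. ring. }
  assert (dsh : is_derive (fun y => sinh (k * y)) x (k * cosh (k * x))).
  { apply (is_derive_comp sinh (fun y => k * y)); [apply is_derive_sinh|].
    auto_derive; auto. ring. }
  unfold beam. set (ch := fun y => cosh (k * y)) in *. set (sh := fun y => sinh (k * y)) in *.
  fold (ch x) (sh x).
  apply (is_derive_ext (fun y => A * cos (k * y) + B * sin (k * y) + C * ch y + D * sh y));
    [reflexivity|].
  auto_derive.
  - repeat split; eexists; [apply dch | apply dsh].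
  - rewrite (is_derive_unique (fun y : R => ch y) _ _ dch), (is_derive_unique (fun y : R => sh y) _ _ dsh).
    fold (ch x) (sh x). ring.
Qed.

Lemma beam_derivative_is_derive (k : R) (n : nat) : forall A B C D x,
  is_derive (beam_derivative k A B C D n) x (beam_derivative k A B C D (S n) x).
Proof.
  induction n as [|n IH]; intros A B C D x.
  - apply beam_is_derive.
  - apply (IH (k * B) (- k * A) (k * D) (k * C) x).
Qed.

(** The operator factors as [D^4 - k^4 = (D^2 + k^2) (D^2 - k^2)]: both
    [u'' - k^2 u] and [u'' + k^2 u] solve an equation of order two, and [u] is a
    multiple of their difference. *)
Lemma solve_beam (k : R) (u : R -> R) :
  0 < k -> C4 u -> (forall x, 0 < x < 1 -> Derive_n u 4 x = k ^ 4 * u x) ->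
  exists A B C D, forall n x, (n <= 3)%nat -> 0 <= x <= 1 ->
    Derive_n u n x = beam_derivative k A B C D n x.
Proof.
  intros Hk Hu Hode.
  pose proof (fun n x => C4_is_derive u n x Hu) as d.
  destruct (solve_trigonometric k
    (fun x => Derive_n u 2 x - k ^ 2 * Derive_n u 0 x)
    (fun x => Derive_n u 3 x - k ^ 2 * Derive_n u 1 x)
    (fun x => Derive_n u 4 x - k ^ 2 * Derive_n u 2 x)) as [A [B Hw]]; auto.
  { intros x. apply @is_derive_minus; [apply d; lia|].
    apply is_derive_scal, d; lia. }
  { intros x. apply @is_derive_minus; [apply d; lia|].
    apply is_derive_scal, d; lia. }
  { intros x Hx. rewrite Hode by assumption. change (Derive_n u 0 x) with (u x). ring. }
  destruct (solve_hyperbolic k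
    (fun x => Derive_n u 2 x + k ^ 2 * Derive_n u 0 x)
    (fun x => Derive_n u 3 x + k ^ 2 * Derive_n u 1 x)
    (fun x => Derive_n u 4 x + k ^ 2 * Derive_n u 2 x)) as [C [D Hv]]; auto.
  { intros x. apply @is_derive_plus; [apply d; lia|].
    apply is_derive_scal, d; lia. }
  { intros x. apply @is_derive_plus; [apply d; lia|].
    apply is_derive_scal, d; lia. }
  { intros x Hx. rewrite Hode by assumption. change (Derive_n u 0 x) with (u x). ring. }
  exists (- A / (2 * k ^ 2)), (- B / (2 * k ^ 2)), (C / (2 * k ^ 2)), (D / (2 * k ^ 2)).
  intros n x Hn Hx. destruct (Hw x Hx) as [W W1]. destruct (Hv x Hx) as [V V1].
  assert (k <> 0) by lra.
  destruct n as [|[|[|[|n]]]]; [| | | |lia]; cbn -[Derive_n cosh sinh cos sin pow];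
    unfold beam.
  - replace (Derive_n u 0 x) with
      (((Derive_n u 2 x + k ^ 2 * Derive_n u 0 x) - (Derive_n u 2 x - k ^ 2 * Derive_n u 0 x))
        / (2 * k ^ 2)) by (field; auto).
    rewrite W, V. field; auto.
  - replace (Derive_n u 1 x) with
      (((Derive_n u 3 x + k ^ 2 * Derive_n u 1 x) - (Derive_n u 3 x - k ^ 2 * Derive_n u 1 x))
        / (2 * k ^ 2)) by (field; auto).
    rewrite W1, V1. field; auto.
  - replace (Derive_n u 2 x) with
      (((Derive_n u 2 x + k ^ 2 * Derive_n u 0 x) + (Derive_n u 2 x - k ^ 2 * Derive_n u 0 x))
        / 2) by (field; auto).
    rewrite W, V. field; auto.
  - replace (Derive_n u 3 x) with
      (((Derive_n u 3 x + k ^ 2 * Derive_n u 1 x) + (Derive_n u 3 x - k ^ 2 * Derive_n u 1 x))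
        / 2) by (field; auto).
    rewrite W1, V1. field; auto.
Qed.

Definition cubic (a b c d x : R) : R := a + b * x + c * x ^ 2 + d * x ^ 3.

Fixpoint cubic_derivative (a b c d : R) (n : nat) : R -> R :=
  match n with
  | 0%nat => cubic a b c d
  | S m => cubic_derivative b (2 * c) (3 * d) 0 m
  end.

Lemma cubic_is_derive (a b c d x : R) :
  is_derive (cubic a b c d) x (cubic b (2 * c) (3 * d) 0 x).
Proof. unfold cubic. auto_derive; [exact I | ring]. Qed.

Lemma cubic_derivative_is_derive (n : nat) : forall a b c d x,
  is_derive (cubic_derivative a b c d n) x (cubic_derivative a b c d (S n) x).
Proof.
  induction n as [|n IH]; intros a b c d x.
  - apply cubic_is_derive.
  - apply (IH b (2 * c) (3 * d) 0 x).
Qed.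

Lemma solve_cubic (u : R -> R) :
  C4 u -> (forall x, 0 < x < 1 -> Derive_n u 4 x = 0) ->
  exists a b c d, forall n x, (n <= 3)%nat -> 0 <= x <= 1 ->
    Derive_n u n x = cubic_derivative a b c d n x.
Proof.
  intros Hu Hode.
  pose proof (fun n x => C4_is_derive u n x Hu) as d.
  set (p := cubic_derivative (Derive_n u 0 0) (Derive_n u 1 0) (Derive_n u 2 0 / 2)
              (Derive_n u 3 0 / 6)).
  (* Integrate the equality of the next derivatives, starting from 0. *)
  assert (step : forall n, (n <= 3)%nat ->
      (forall x, 0 < x < 1 -> Derive_n u (S n) x = p (S n) x) ->
      Derive_n u n 0 = p n 0 ->
      forall x, 0 <= x <= 1 -> Derive_n u n x = p n x).
  { intros n Hn H1 H0 x Hx.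
    assert (E : Derive_n u n x - p n x = Derive_n u n 0 - p n 0).
    { apply (constant_of_derive_0 (fun y => Derive_n u n y - p n y)
               (fun y => Derive_n u (S n) y - p (S n) y)); auto.
      - intros y. apply @is_derive_minus; [apply d, Hn|].
        apply cubic_derivative_is_derive.
      - intros y Hy. rewrite H1 by assumption. ring. }
    lra. }
  assert (E3 : forall x, 0 <= x <= 1 -> Derive_n u 3 x = p 3%nat x).
  { apply step; [lia| |].
    - intros x Hx. rewrite Hode by assumption.
      cbn -[Derive_n]. unfold cubic. field.
    - cbn -[Derive_n]. unfold cubic. field. }
  assert (E2 : forall x, 0 <= x <= 1 -> Derive_n u 2 x = p 2%nat x).
  { apply step; [lia| |].
    - intros x Hx. apply E3. lra.
    - cbn -[Derive_n]. unfold cubic. field. }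
  assert (E1 : forall x, 0 <= x <= 1 -> Derive_n u 1 x = p 1%nat x).
  { apply step; [lia| |].
    - intros x Hx. apply E2. lra.
    - cbn -[Derive_n]. unfold cubic. field. }
  assert (E0 : forall x, 0 <= x <= 1 -> Derive_n u 0 x = p 0%nat x).
  { apply step; [lia| |].
    - intros x Hx. apply E1. lra.
    - cbn -[Derive_n]. unfold cubic. field. }
  exists (Derive_n u 0 0), (Derive_n u 1 0), (Derive_n u 2 0 / 2), (Derive_n u 3 0 / 6).
  intros n x Hn Hx. fold p.
  destruct n as [|[|[|[|n]]]]; auto; lia.
Qed.

(** * Dimensions of the eigenspaces *)

(** The energy identity [int u'''' u = int (u'')^2], in differential form: the
    boundary term [u u''' - u' u''] has derivative [lam u^2 - (u'')^2]. *)
Lemma negative_no_mode_energy (lam : R) (u : R -> R) :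
  lam < 0 -> C4 u -> (forall x, 0 < x < 1 -> Derive_n u 4 x = lam * u x) ->
  Derive_n u 0 0 * Derive_n u 3 0 - Derive_n u 1 0 * Derive_n u 2 0 = 0 ->
  Derive_n u 0 1 * Derive_n u 3 1 - Derive_n u 1 1 * Derive_n u 2 1 = 0 ->
  forall x, 0 <= x <= 1 -> u x = 0.
Proof.
  intros Hlam Hu Hode B0 B1.
  pose proof (fun n x => C4_is_derive u n x Hu) as d.
  assert (Hz : forall x, 0 < x < 1 -> u x = 0).
  { intros x Hx.
    assert (E : - (Derive_n u 0 x * Derive_n u 4 x - Derive_n u 2 x * Derive_n u 2 x) = 0).
    { revert x Hx. apply (derive_0_of_monotone
        (fun x => - (Derive_n u 0 x * Derive_n u 3 x - Derive_n u 1 x * Derive_n u 2 x))).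
      - intros x.
        replace (Derive_n u 0 x * Derive_n u 4 x - Derive_n u 2 x * Derive_n u 2 x) with
          ((Derive_n u 1 x * Derive_n u 3 x + Derive_n u 0 x * Derive_n u 4 x)
           - (Derive_n u 2 x * Derive_n u 2 x + Derive_n u 1 x * Derive_n u 3 x)) by ring.
        apply @is_derive_opp, @is_derive_minus;
          apply @is_derive_mult; try (apply d; lia); intros; apply Rmult_comm.
      - intros x Hx. rewrite Hode by assumption. change (Derive_n u 0 x) with (u x). nra.
      - rewrite B0, B1. reflexivity. }
    rewrite Hode in E by assumption. change (Derive_n u 0 x) with (u x) in E.
    assert (u x * u x = 0) by nra. nra. }
  assert (Hc : forall x, 0 <= x <= 1 -> u x = u 0).
  { apply (constant_of_derive_0 u (Derive_n u 1)); [intros y; apply (d 0%nat); lia|].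
    apply (derive_0_of_constant u _ 0); [intros y; apply (d 0%nat); lia | exact Hz]. }
  intros x Hx. rewrite Hc, <- (Hc (1 / 2)) by lra. apply Hz. lra.
Qed.

(** The boundary conditions of the mixed problems do not annihilate the energy of
    [u], but that of the pair [u, u'']: the boundary term [u'' u''' - lam u u']
    has derivative [(u''')^2 - lam (u')^2]. *)
Lemma negative_no_mode_mixed (lam : R) (u : R -> R) :
  lam < 0 -> C4 u -> (forall x, 0 < x < 1 -> Derive_n u 4 x = lam * u x) ->
  Derive_n u 2 0 * Derive_n u 3 0 = 0 -> Derive_n u 0 0 * Derive_n u 1 0 = 0 ->
  Derive_n u 2 1 * Derive_n u 3 1 = 0 -> Derive_n u 0 1 * Derive_n u 1 1 = 0 ->
  forall x, 0 <= x <= 1 -> u x = 0.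
Proof.
  intros Hlam Hu Hode B0 B0' B1 B1'.
  pose proof (fun n x => C4_is_derive u n x Hu) as d.
  assert (Hz : forall x, 0 < x < 1 -> Derive_n u 1 x = 0).
  { intros x Hx.
    assert (E : (Derive_n u 3 x * Derive_n u 3 x + Derive_n u 2 x * Derive_n u 4 x)
           - lam * (Derive_n u 1 x * Derive_n u 1 x + Derive_n u 0 x * Derive_n u 2 x) = 0).
    { revert x Hx. apply (derive_0_of_monotone
        (fun x => Derive_n u 2 x * Derive_n u 3 x - lam * (Derive_n u 0 x * Derive_n u 1 x))).
      - intros x.
        apply @is_derive_minus; [|apply is_derive_scal];
          apply @is_derive_mult; try (apply d; lia); intros; apply Rmult_comm.
      - intros x Hx. rewrite Hode by assumption. change (Derive_n u 0 x) with (u x). nra.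
      - rewrite B0, B1, B0', B1'. reflexivity. }
    rewrite Hode in E by assumption. change (Derive_n u 0 x) with (u x) in E.
    assert (Derive_n u 1 x * Derive_n u 1 x = 0) by nra. nra. }
  assert (Hc : forall x, 0 <= x <= 1 -> u x = u 0).
  { apply (constant_of_derive_0 u (Derive_n u 1)); [intros y; apply (d 0%nat); lia | exact Hz]. }
  assert (H2 : forall x, 0 < x < 1 -> Derive_n u 2 x = 0)
    by (apply (derive_0_of_constant (Derive_n u 1) _ 0); [intros y; apply d; lia | exact Hz]).
  assert (H3 : forall x, 0 < x < 1 -> Derive_n u 3 x = 0)
    by (apply (derive_0_of_constant (Derive_n u 2) _ 0); [intros y; apply d; lia | exact H2]).
  assert (H4 : forall x, 0 < x < 1 -> Derive_n u 4 x = 0)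
    by (apply (derive_0_of_constant (Derive_n u 3) _ 0); [intros y; apply d; lia | exact H3]).
  intros x Hx. rewrite Hc by assumption.
  assert (E : lam * u (1 / 2) = 0) by (rewrite <- Hode by lra; apply H4; lra).
  rewrite Hc in E by lra.
  apply Rmult_integral in E. destruct E; [lra | assumption].
Qed.

Lemma negative_dim (i j : nat) (lam : R) :
  In (i, j) boundary_pairs -> lam < 0 -> has_dim (eigenspace i j lam) 0.
Proof.
  intros Hij Hlam. apply has_dim_0. intros u [Hu [Hode [B1 [B2 [B3 B4]]]]].
  assert (energy : (Derive_n u 0 0 * Derive_n u 3 0 - Derive_n u 1 0 * Derive_n u 2 0 = 0 /\
             Derive_n u 0 1 * Derive_n u 3 1 - Derive_n u 1 1 * Derive_n u 2 1 = 0) \/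
            (Derive_n u 2 0 * Derive_n u 3 0 = 0 /\ Derive_n u 0 0 * Derive_n u 1 0 = 0 /\
             Derive_n u 2 1 * Derive_n u 3 1 = 0 /\ Derive_n u 0 1 * Derive_n u 1 1 = 0)).
  { unfold boundary_pairs in Hij. simpl In in Hij.
    destruct Hij as [E | [E | [E | [E | [E | [E | []]]]]]]; injection E; intros; subst i j;
      rewrite B1, B2, B3, B4;
      first [left; split; ring | right; repeat split; ring]. }
  destruct energy as [[H1 H2] | [H1 [H2 [H3 H4]]]].
  - apply (negative_no_mode_energy lam); assumption.
  - apply (negative_no_mode_mixed lam); assumption.
Qed.

(** The derivatives of [beam k A B C D], up to the factor [k^n]. *)
Definition beam_trace (k A B C D : R) (n : nat) : R -> R :=
  match n with
  | 0%nat => beam k A B C D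
  | 1%nat => beam k B (- A) D C
  | 2%nat => beam k (- A) (- B) C D
  | _ => beam k (- B) A D C
  end.

Lemma beam_derivative_trace (k A B C D : R) (n : nat) (x : R) :
  (n <= 3)%nat -> beam_derivative k A B C D n x = k ^ n * beam_trace k A B C D n x.
Proof.
  intros Hn. destruct n as [|[|[|[|n]]]]; [| | | |lia];
    cbn -[cosh sinh cos sin]; unfold beam; ring.
Qed.

Lemma beam_at_0 (k A B C D : R) : beam k A B C D 0 = A + C.
Proof.
  unfold beam. rewrite Rmult_0_r, cos_0, sin_0, cosh_0, sinh_0. ring.
Qed.

Lemma beam_at_1 (k A B C D : R) :
  beam k A B C D 1 = A * cos k + B * sin k + C * cosh k + D * sinh k.
Proof. unfold beam. rewrite Rmult_1_r. reflexivity. Qed.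

(** The boundary conditions, freed of the factors [k^n]. *)
Definition beam_system (i j : nat) (k A B C D : R) : Prop :=
  beam_trace k A B C D i 0 = 0 /\ beam_trace k A B C D j 0 = 0 /\
  beam_trace k A B C D i 1 = 0 /\ beam_trace k A B C D j 1 = 0.

Lemma eigenspace_beam (i j : nat) (k A B C D : R) :
  (i <= 3)%nat -> (j <= 3)%nat -> beam_system i j k A B C D ->
  eigenspace i j (k ^ 4) (beam k A B C D).
Proof.
  intros Hi Hj [B1 [B2 [B3 B4]]].
  destruct (derivative_chain (beam_derivative k A B C D)) as [H4 Hd].
  { intros n x. apply beam_derivative_is_derive. }
  change (beam_derivative k A B C D 0) with (beam k A B C D) in *.
  split; [exact H4|]. split.
  - intros x _. rewrite Hd. cbn -[cosh sinh cos sin pow]. unfold beam. ring.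
  - rewrite !Hd, !beam_derivative_trace, B1, B2, B3, B4 by assumption.
    repeat split; ring.
Qed.

Lemma eigenspace_beam_inv (i j : nat) (k : R) (u : R -> R) :
  (i <= 3)%nat -> (j <= 3)%nat -> 0 < k -> eigenspace i j (k ^ 4) u ->
  exists A B C D, beam_system i j k A B C D /\
    forall x, 0 <= x <= 1 -> u x = beam k A B C D x.
Proof.
  intros Hi Hj Hk [Hu [Hode [B1 [B2 [B3 B4]]]]].
  destruct (solve_beam k u Hk Hu Hode) as [A [B [C [D HD]]]].
  exists A, B, C, D. split.
  - assert (Hz : forall n x, (n <= 3)%nat -> 0 <= x <= 1 -> Derive_n u n x = 0 ->
              beam_trace k A B C D n x = 0).
    { intros n x Hn Hx H. rewrite HD, beam_derivative_trace in H by assumption.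
      apply Rmult_integral in H. destruct H as [H|H]; [|exact H].
      exfalso. revert H. apply pow_nonzero. lra. }
    repeat split; apply Hz; auto; lra.
  - intros x Hx. apply (HD 0%nat x); [lia | exact Hx].
Qed.

(** The four functions in [beam] are independent, as their Wronskian at any point
    splits into a rotation and a hyperbolic rotation. *)
Lemma beam_independent (k A B C D : R) :
  0 < k -> (forall x, 0 <= x <= 1 -> beam k A B C D x = 0) ->
  A = 0 /\ B = 0 /\ C = 0 /\ D = 0.
Proof.
  intros Hk H.
  set (f := beam_derivative k A B C D).
  assert (Hf : forall n x, 0 < x < 1 -> f n x = 0).
  { induction n as [|n IH].
    - intros x Hx. apply H. lra.
    - apply (derive_0_of_constant (f n) _ 0); [|exact IH].
      intros x. apply beam_derivative_is_derive. }
  assert (Ht : forall n, (n <= 3)%nat -> beam_trace k A B C D n (1 / 2) = 0).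
  { intros n Hn. assert (E : f n (1 / 2) = 0) by (apply Hf; lra).
    unfold f in E. rewrite beam_derivative_trace in E by assumption.
    apply Rmult_integral in E. destruct E as [E|E]; [|exact E].
    exfalso. revert E. apply pow_nonzero. lra. }
  pose proof (Ht 0%nat) as T0. pose proof (Ht 1%nat) as T1.
  pose proof (Ht 2%nat) as T2. pose proof (Ht 3%nat) as T3.
  cbn -[cosh sinh cos sin] in T0, T1, T2, T3. unfold beam in T0, T1, T2, T3.
  specialize (T0 ltac:(lia)). specialize (T1 ltac:(lia)).
  specialize (T2 ltac:(lia)). specialize (T3 ltac:(lia)).
  pose proof (cos2_sin2 (k * (1 / 2))) as E1. pose proof (cosh2_sinh2 (k * (1 / 2))) as E2.
  set (c := cos (k * (1 / 2))) in *. set (s := sin (k * (1 / 2))) in *.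
  set (ch := cosh (k * (1 / 2))) in *. set (sh := sinh (k * (1 / 2))) in *.
  assert (P : A * c + B * s = 0) by lra. assert (P' : B * c - A * s = 0) by lra.
  assert (Q : C * ch + D * sh = 0) by lra. assert (Q' : C * sh + D * ch = 0) by lra.
  repeat split.
  - replace A with (A * (c * c + s * s)) by (rewrite E1; ring).
    replace (A * (c * c + s * s)) with (c * (A * c + B * s) - s * (B * c - A * s)) by ring.
    rewrite P, P'. ring.
  - replace B with (B * (c * c + s * s)) by (rewrite E1; ring).
    replace (B * (c * c + s * s)) with (s * (A * c + B * s) + c * (B * c - A * s)) by ring.
    rewrite P, P'. ring.
  - replace C with (C * (ch * ch - sh * sh)) by (rewrite E2; ring).
    replace (C * (ch * ch - sh * sh)) with (ch * (C * ch + D * sh) - sh * (C * sh + D * ch)) by ring.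
    rewrite Q, Q'. ring.
  - replace D with (D * (ch * ch - sh * sh)) by (rewrite E2; ring).
    replace (D * (ch * ch - sh * sh)) with (ch * (C * sh + D * ch) - sh * (C * ch + D * sh)) by ring.
    rewrite Q, Q'. ring.
Qed.

Lemma beam_dim_0 (i j : nat) (k : R) :
  (i <= 3)%nat -> (j <= 3)%nat -> 0 < k ->
  (forall A B C D, beam_system i j k A B C D -> A = 0 /\ B = 0 /\ C = 0 /\ D = 0) ->
  has_dim (eigenspace i j (k ^ 4)) 0.
Proof.
  intros Hi Hj Hk H. apply has_dim_0. intros u Hu x Hx.
  destruct (eigenspace_beam_inv i j k u Hi Hj Hk Hu) as [A [B [C [D [HS HD]]]]].
  destruct (H A B C D HS) as [-> [-> [-> ->]]]. rewrite HD by assumption.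
  unfold beam. ring.
Qed.

Lemma beam_dim_1 (i j : nat) (k A0 B0 C0 D0 : R) :
  (i <= 3)%nat -> (j <= 3)%nat -> 0 < k -> beam_system i j k A0 B0 C0 D0 ->
  ~ (A0 = 0 /\ B0 = 0 /\ C0 = 0 /\ D0 = 0) ->
  (forall A B C D, beam_system i j k A B C D ->
     exists t, A = t * A0 /\ B = t * B0 /\ C = t * C0 /\ D = t * D0) ->
  has_dim (eigenspace i j (k ^ 4)) 1.
Proof.
  intros Hi Hj Hk HS Hne H.
  assert (Hx0 : exists x0, 0 <= x0 <= 1 /\ beam k A0 B0 C0 D0 x0 <> 0).
  { apply NNPP. intros Hno. apply Hne. apply (beam_independent k); [exact Hk|].
    intros x Hx. apply NNPP. intros Hx'. apply Hno. exists x. auto. }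
  destruct Hx0 as [x0 [Hx0 Hb]].
  apply (has_dim_1 _ (beam k A0 B0 C0 D0) x0); auto.
  - apply eigenspace_beam; assumption.
  - intros u Hu.
    destruct (eigenspace_beam_inv i j k u Hi Hj Hk Hu) as [A [B [C [D [HS' HD]]]]].
    destruct (H A B C D HS') as [t [-> [-> [-> ->]]]].
    exists t. intros x Hx. rewrite HD by assumption. unfold beam. ring.
Qed.

Lemma cosh_pos (k : R) : 0 < cosh k.
Proof. unfold cosh. pose proof (exp_pos k). pose proof (exp_pos (- k)). lra. Qed.

Lemma sinh_pos (k : R) : 0 < k -> 0 < sinh k.
Proof. intros Hk. rewrite <- sinh_0. apply sinh_lt, Hk. Qed.

Lemma cosh_gt_1 (k : R) : 0 < k -> 1 < cosh k.
Proof.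
  intros Hk. pose proof (sinh_pos k Hk). pose proof (cosh2_sinh2 k).
  pose proof (cosh_pos k).
  nra.
Qed.

Ltac beam_equations H :=
  unfold beam_system, beam_trace in H; rewrite ?beam_at_0, ?beam_at_1 in H.

Lemma navier_dim_0 (k : R) :
  0 < k -> sin k <> 0 -> has_dim (eigenspace 0 2 (k ^ 4)) 0.
Proof.
  intros Hk Hs. apply beam_dim_0; try lia; [exact Hk|].
  intros A B C D H. beam_equations H. destruct H as [H1 [H2 [H3 H4]]].
  pose proof (sinh_pos k Hk).
  assert (A = 0) by lra. assert (C = 0) by lra. subst A C.
  assert (D * sinh k = 0) by lra. assert (B * sin k = 0) by lra. repeat split; nra.
Qed.

Lemma navier_dim_1 (k : R) :
  0 < k -> sin k = 0 -> has_dim (eigenspace 0 2 (k ^ 4)) 1.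
Proof.
  intros Hk Hs. apply (beam_dim_1 0 2 k 0 1 0 0); try lia; try lra.
  - unfold beam_system, beam_trace. rewrite !beam_at_0, !beam_at_1, Hs.
    repeat split; ring.
  - intros A B C D H. beam_equations H. destruct H as [H1 [H2 [H3 H4]]].
    pose proof (sinh_pos k Hk).
    assert (A = 0) by lra. assert (C = 0) by lra. subst A C.
    assert (D * sinh k = 0) by lra. exists B. repeat split; nra.
Qed.

Lemma kuttler_sigillito_dim_0 (k : R) :
  0 < k -> sin k <> 0 -> has_dim (eigenspace 1 3 (k ^ 4)) 0.
Proof.
  intros Hk Hs. apply beam_dim_0; try lia; [exact Hk|].
  intros A B C D H. beam_equations H. destruct H as [H1 [H2 [H3 H4]]].
  pose proof (sinh_pos k Hk).
  assert (B = 0) by lra. assert (D = 0) by lra. subst B D.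
  assert (C * sinh k = 0) by lra. assert (A * sin k = 0) by lra. repeat split; nra.
Qed.

Lemma kuttler_sigillito_dim_1 (k : R) :
  0 < k -> sin k = 0 -> has_dim (eigenspace 1 3 (k ^ 4)) 1.
Proof.
  intros Hk Hs. apply (beam_dim_1 1 3 k 1 0 0 0); try lia; try lra.
  - unfold beam_system, beam_trace. rewrite !beam_at_0, !beam_at_1, Hs.
    repeat split; ring.
  - intros A B C D H. beam_equations H. destruct H as [H1 [H2 [H3 H4]]].
    pose proof (sinh_pos k Hk).
    assert (B = 0) by lra. assert (D = 0) by lra. subst B D.
    assert (C * sinh k = 0) by lra. exists A. repeat split; nra.
Qed.

(** Up to sign, the determinant of each of the four remaining systems, once two
    unknowns have been eliminated at the end 0. *)
Lemma frequency_determinant (k : R) :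
  (cos k - cosh k) * (cos k - cosh k) + (sin k - sinh k) * (sin k + sinh k) =
  2 * (1 - cos k * cosh k).
Proof. pose proof (cos2_sin2 k). pose proof (cosh2_sinh2 k). lra. Qed.

Lemma frequency_sin_lt_sinh (k : R) :
  0 < k -> cos k * cosh k = 1 -> sin k - sinh k < 0.
Proof.
  intros Hk Hroot. pose proof (cos2_sin2 k). pose proof (cosh2_sinh2 k).
  pose proof (sinh_pos k Hk). pose proof (cosh_gt_1 k Hk).
  assert (0 < cos k < 1) by nra.
  (* [sin^2 = 1 - 1/cosh^2 < cosh^2 - 1 = sinh^2] *)
  assert (sin k * sin k < sinh k * sinh k) by nra. nra.
Qed.

(** The pairs whose positive eigenvalues come from [cos k cosh k = 1]. *)
Definition clamped_family (i j : nat) : Prop :=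
  (i = 0 /\ j = 1 \/ i = 2 /\ j = 3 \/ i = 1 /\ j = 2 \/ i = 0 /\ j = 3)%nat.

Lemma homogeneous_2x2 (a b c d x y : R) :
  a * d - b * c <> 0 -> x * a + y * b = 0 -> x * c + y * d = 0 -> x = 0 /\ y = 0.
Proof.
  intros Hdet E1 E2. split; apply (Rmult_eq_reg_r (a * d - b * c)); auto.
  - replace (x * (a * d - b * c)) with (d * (x * a + y * b) - b * (x * c + y * d)) by ring.
    rewrite E1, E2. ring.
  - replace (y * (a * d - b * c)) with (a * (x * c + y * d) - c * (x * a + y * b)) by ring.
    rewrite E1, E2. ring.
Qed.

Lemma clamped_dim_0 (i j : nat) (k : R) :
  clamped_family i j -> 0 < k -> cos k * cosh k <> 1 ->
  has_dim (eigenspace i j (k ^ 4)) 0.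
Proof.
  intros Hij Hk Hno. pose proof (frequency_determinant k) as Hdet.
  apply beam_dim_0; [unfold clamped_family in Hij; lia | unfold clamped_family in Hij; lia | exact Hk |].
  intros A B C D H.
  destruct Hij as [[-> ->] | [[-> ->] | [[-> ->] | [-> ->]]]]; beam_equations H;
    destruct H as [H1 [H2 [H3 H4]]].
  - assert (C = - A) by lra. assert (D = - B) by lra. subst C D.
    destruct (homogeneous_2x2 (cos k - cosh k) (sin k - sinh k)
      (- (sin k + sinh k)) (cos k - cosh k) A B) as [-> ->]; repeat split; lra.
  - assert (C = A) by lra. assert (D = B) by lra. subst C D.
    destruct (homogeneous_2x2 (cos k - cosh k) (sin k - sinh k)
      (- (sin k + sinh k)) (cos k - cosh k) A B) as [-> ->]; repeat split; lra.
  - assert (C = A) by lra. assert (D = - B) by lra. subst C D.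
    destruct (homogeneous_2x2 (sinh k - sin k) (cos k - cosh k)
      (cos k - cosh k) (sin k + sinh k) A B) as [-> ->]; repeat split; lra.
  - assert (C = - A) by lra. assert (D = B) by lra. subst C D.
    destruct (homogeneous_2x2 (cos k - cosh k) (sin k + sinh k)
      (sin k - sinh k) (cosh k - cos k) A B) as [-> ->]; repeat split; lra.
Qed.

(** The determinant vanishes, so the cofactors of the reduced system give a mode;
    [sin k - sinh k], one of its entries, is nonzero, so the rank is one. *)
Lemma clamped_dim_1 (i j : nat) (k : R) :
  clamped_family i j -> 0 < k -> cos k * cosh k = 1 ->
  has_dim (eigenspace i j (k ^ 4)) 1.
Proof.
  intros Hij Hk Hroot. pose proof (frequency_determinant k) as Hdet.
  pose proof (frequency_sin_lt_sinh k Hk Hroot) as Hq.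
  rewrite Hroot, Rminus_diag, Rmult_0_r in Hdet.
  destruct Hij as [[-> ->] | [[-> ->] | [[-> ->] | [-> ->]]]].
  - apply (beam_dim_1 0 1 k (sin k - sinh k) (cosh k - cos k) (sinh k - sin k) (cos k - cosh k));
      try lia; try lra.
    + unfold beam_system, beam_trace. rewrite !beam_at_0, !beam_at_1. repeat split; lra.
    + intros A B C D H. beam_equations H. destruct H as [H1 [H2 [H3 H4]]].
      assert (C = - A) by lra. assert (D = - B) by lra. subst C D.
      assert (E : B = - (A * (cos k - cosh k)) / (sin k - sinh k))
        by (apply (Rmult_eq_reg_r (sin k - sinh k)); [field_simplify; lra | lra]).
      exists (A / (sin k - sinh k)). rewrite E. repeat split; field; lra.
  - apply (beam_dim_1 2 3 k (sin k - sinh k) (cosh k - cos k) (sin k - sinh k) (cosh k - cos k));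
      try lia; try lra.
    + unfold beam_system, beam_trace. rewrite !beam_at_0, !beam_at_1. repeat split; lra.
    + intros A B C D H. beam_equations H. destruct H as [H1 [H2 [H3 H4]]].
      assert (C = A) by lra. assert (D = B) by lra. subst C D.
      assert (E : B = - (A * (cos k - cosh k)) / (sin k - sinh k))
        by (apply (Rmult_eq_reg_r (sin k - sinh k)); [field_simplify; lra | lra]).
      exists (A / (sin k - sinh k)). rewrite E. repeat split; field; lra.
  - apply (beam_dim_1 1 2 k (cos k - cosh k) (sin k - sinh k) (cos k - cosh k) (sinh k - sin k));
      try lia; try lra.
    + unfold beam_system, beam_trace. rewrite !beam_at_0, !beam_at_1. repeat split; lra.
    + intros A B C D H. beam_equations H. destruct H as [H1 [H2 [H3 H4]]].
      assert (C = A) by lra. assert (D = - B) by lra. subst C D.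
      assert (E : A = B * (cos k - cosh k) / (sin k - sinh k))
        by (apply (Rmult_eq_reg_r (sin k - sinh k)); [field_simplify; lra | lra]).
      exists (B / (sin k - sinh k)). rewrite E. repeat split; field; lra.
  - apply (beam_dim_1 0 3 k (cos k - cosh k) (sin k - sinh k) (cosh k - cos k) (sin k - sinh k));
      try lia; try lra.
    + unfold beam_system, beam_trace. rewrite !beam_at_0, !beam_at_1. repeat split; lra.
    + intros A B C D H. beam_equations H. destruct H as [H1 [H2 [H3 H4]]].
      assert (C = - A) by lra. assert (D = B) by lra. subst C D.
      assert (E : A = B * (cos k - cosh k) / (sin k - sinh k))
        by (apply (Rmult_eq_reg_r (sin k - sinh k)); [field_simplify; lra | lra]).
      exists (B / (sin k - sinh k)). rewrite E. repeat split; field; lra.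
Qed.

Definition cubic_system (i j : nat) (a b c d : R) : Prop :=
  cubic_derivative a b c d i 0 = 0 /\ cubic_derivative a b c d j 0 = 0 /\
  cubic_derivative a b c d i 1 = 0 /\ cubic_derivative a b c d j 1 = 0.

Lemma eigenspace_cubic (i j : nat) (a b c d : R) :
  cubic_system i j a b c d -> eigenspace i j 0 (cubic a b c d).
Proof.
  intros H. destruct (derivative_chain (cubic_derivative a b c d)) as [H4 Hd].
  { intros n x. apply cubic_derivative_is_derive. }
  change (cubic_derivative a b c d 0) with (cubic a b c d) in *.
  split; [exact H4|]. split.
  - intros x _. rewrite Hd. cbn -[pow]. unfold cubic. ring.
  - rewrite !Hd. exact H.
Qed.

Lemma eigenspace_cubic_inv (i j : nat) (u : R -> R) :
  (i <= 3)%nat -> (j <= 3)%nat -> eigenspace i j 0 u ->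
  exists a b c d, cubic_system i j a b c d /\
    forall x, 0 <= x <= 1 -> u x = cubic a b c d x.
Proof.
  intros Hi Hj [Hu [Hode [B1 [B2 [B3 B4]]]]].
  destruct (solve_cubic u Hu) as [a [b [c [d Hd]]]].
  { intros x Hx. rewrite Hode by assumption. ring. }
  exists a, b, c, d. split.
  - unfold cubic_system. rewrite <- !Hd by (assumption || lra). auto.
  - intros x Hx. apply (Hd 0%nat x); [lia | exact Hx].
Qed.

Ltac cubic_equations H :=
  unfold cubic_system, cubic_derivative, cubic in H; destruct H as [? [? [? ?]]].

Lemma zero_dim_0 (j : nat) :
  (j = 1 \/ j = 2)%nat -> has_dim (eigenspace 0 j 0) 0.
Proof.
  intros Hj. apply has_dim_0. intros u Hu x Hx.
  destruct (eigenspace_cubic_inv 0 j u) as [a [b [c [d [HS ->]]]]]; auto; try lia.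
  destruct Hj as [-> | ->]; cubic_equations HS;
    assert (a = 0) by lra; assert (b = 0) by lra; assert (c = 0) by lra;
    assert (d = 0) by lra; subst; unfold cubic; ring.
Qed.

Lemma zero_dim_1 (i j : nat) :
  (i = 0 /\ j = 3 \/ i = 1 /\ j = 2 \/ i = 1 /\ j = 3)%nat ->
  has_dim (eigenspace i j 0) 1.
Proof.
  intros [[-> ->] | [[-> ->] | [-> ->]]].
  - apply (has_dim_1 _ (cubic 0 1 (-1) 0) (1 / 2)); try lra.
    + apply eigenspace_cubic. unfold cubic_system, cubic_derivative, cubic. repeat split; ring.
    + unfold cubic. lra.
    + intros u Hu.
      destruct (eigenspace_cubic_inv 0 3 u) as [a [b [c [d [HS Heq]]]]]; auto; try lia.
      cubic_equations HS. exists b. intros x Hx. rewrite Heq by assumption.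
      assert (a = 0) by lra. assert (d = 0) by lra. assert (c = - b) by lra. subst.
      unfold cubic. ring.
  - apply (has_dim_1 _ (cubic 1 0 0 0) 0); try lra.
    + apply eigenspace_cubic. unfold cubic_system, cubic_derivative, cubic. repeat split; ring.
    + unfold cubic. lra.
    + intros u Hu.
      destruct (eigenspace_cubic_inv 1 2 u) as [a [b [c [d [HS Heq]]]]]; auto; try lia.
      cubic_equations HS. exists a. intros x Hx. rewrite Heq by assumption.
      assert (b = 0) by lra. assert (c = 0) by lra. assert (d = 0) by lra. subst.
      unfold cubic. ring.
  - apply (has_dim_1 _ (cubic 1 0 0 0) 0); try lra.
    + apply eigenspace_cubic. unfold cubic_system, cubic_derivative, cubic. repeat split; ring.
    + unfold cubic. lra.
    + intros u Hu.
      destruct (eigenspace_cubic_inv 1 3 u) as [a [b [c [d [HS Heq]]]]]; auto; try lia.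
      cubic_equations HS. exists a. intros x Hx. rewrite Heq by assumption.
      assert (b = 0) by lra. assert (d = 0) by lra. assert (c = 0) by lra. subst.
      unfold cubic. ring.
Qed.

Lemma zero_dim_2 : has_dim (eigenspace 2 3 0) 2.
Proof.
  set (f := fun n => if Nat.eqb n 1 then cubic 1 0 0 0 else cubic 0 1 0 0).
  assert (Hf : forall a x, lin_comb 2 a f x = a 1%nat + a 2%nat * x).
  { intros a x. rewrite !lin_comb_S, lin_comb_0. unfold f, cubic. simpl. ring. }
  exists f. split; [|split].
  - intros n _. unfold f. destruct (Nat.eqb n 1); apply eigenspace_cubic;
      unfold cubic_system, cubic_derivative, cubic; repeat split; ring.
  - intros a Ha n Hn.
    pose proof (Ha 0 ltac:(lra)) as E0. pose proof (Ha 1 ltac:(lra)) as E1.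
    rewrite Hf in E0, E1. assert (n = 1 \/ n = 2)%nat as [-> | ->] by lia; lra.
  - intros u Hu.
    destruct (eigenspace_cubic_inv 2 3 u) as [a [b [c [d [HS Heq]]]]]; auto; try lia.
    cubic_equations HS. exists (fun n => if Nat.eqb n 1 then a else b).
    intros x Hx. rewrite Heq, Hf by assumption. simpl.
    assert (c = 0) by lra. assert (d = 0) by lra. subst. unfold cubic. ring.
Qed.

(** * The roots of cos k cosh k = 1 *)

(** The angle whose cosine is [1 / cosh k]; it turns [cos k cosh k = 1] into the
    equality of two cosines. *)
Definition gudermannian (k : R) : R := atan (sinh k).

Lemma gudermannian_is_derive (k : R) : is_derive gudermannian k (/ cosh k).
Proof.
  pose proof (cosh2_sinh2 k) as E.
  pose proof (cosh_pos k) as Hc.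
  replace (/ cosh k) with (cosh k * / (1 + (sinh k)²)).
  - apply (is_derive_comp atan sinh); [apply is_derive_atan | apply is_derive_sinh].
  - unfold Rsqr. replace (1 + sinh k * sinh k) with (cosh k * cosh k) by lra.
    field. lra.
Qed.

Lemma gudermannian_range (k : R) : 0 < k -> 0 < gudermannian k < PI / 2.
Proof.
  intros Hk. pose proof (sinh_pos k Hk). unfold gudermannian. split.
  - rewrite <- atan_0. apply atan_increasing. assumption.
  - apply atan_bound.
Qed.

Lemma cos_gudermannian (k : R) : cos (gudermannian k) = / cosh k.
Proof.
  unfold gudermannian. rewrite cos_atan. pose proof (cosh2_sinh2 k) as E.
  pose proof (cosh_pos k) as Hc.
  unfold Rsqr. replace (1 + sinh k * sinh k) with (cosh k * cosh k) by lra.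
  rewrite sqrt_square by lra. unfold Rdiv. ring.
Qed.

(** The positive roots satisfy [k = 2 pi m + gd k] or [k = 2 pi m - gd k].  With
    [e = (-1)^n] both cases read [phase e k = (n + 1/2) pi]. *)
Definition phase (e k : R) : R := k + e * (PI / 2 - gudermannian k).

Lemma phase_is_derive (e k : R) : is_derive (phase e) k (1 - e * / cosh k).
Proof.
  apply (is_derive_ext (fun y => y + e * (PI / 2 - gudermannian y))); [reflexivity|].
  auto_derive.
  - eexists. apply gudermannian_is_derive.
  - rewrite (is_derive_unique (fun y : R => gudermannian y) _ _ (gudermannian_is_derive k)). ring.
Qed.

Lemma phase_increasing (e x y : R) :
  -1 <= e <= 1 -> 0 <= x -> x < y -> phase e x < phase e y.
Proof.
  intros He Hx Hxy.
  destruct (mean_value (phase e) _ x y (phase_is_derive e) Hxy) as [c [Hc E]].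
  pose proof (cosh_gt_1 c ltac:(lra)) as Hch.
  assert (0 < / cosh c < 1).
  { split; [apply Rinv_0_lt_compat; lra|]. rewrite <- Rinv_1.
    apply Rinv_lt_contravar; lra. }
  assert (0 < 1 - e * / cosh c) by nra. nra.
Qed.

Lemma sign_cases (n : nat) : (-1) ^ n = 1 \/ (-1) ^ n = -1.
Proof. induction n as [|n [IH|IH]]; simpl; rewrite ?IH; lra. Qed.

Lemma sign_bound (n : nat) : -1 <= (-1) ^ n <= 1.
Proof. destruct (sign_cases n); lra. Qed.

(** The correction to [k] in [phase] is smaller than [PI / 2], half the length of
    the interval. *)
Lemma frequency_exists (m : nat) :
  {k : R | INR (S m) * PI <= k <= INR (S m) * PI + PI /\
           phase ((-1) ^ S m) k - (INR (S m) + 1 / 2) * PI = 0}.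
Proof.
  pose proof PI_RGT_0 as HPI. pose proof (pos_INR m) as Hm.
  pose proof (sign_bound (S m)) as He. rewrite S_INR in *.
  assert (Hpos : 0 < (INR m + 1) * PI) by nra.
  apply (IVT (fun k => phase ((-1) ^ S m) k - (INR m + 1 + 1 / 2) * PI)).
  - intros k. apply continuity_pt_minus; [|apply continuity_pt_const; intros ? ?; reflexivity].
    apply derivable_continuous_pt.
    exists (1 - (-1) ^ S m * / cosh k). apply is_derive_Reals, phase_is_derive.
  - lra.
  - pose proof (gudermannian_range _ Hpos). unfold phase.
    set (e := (-1) ^ S m) in *. nra.
  - pose proof (gudermannian_range ((INR m + 1) * PI + PI) ltac:(lra)). unfold phase.
    set (e := (-1) ^ S m) in *. nra.
Qed.

(** The positive roots in increasing order, preceded by 0. *)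
Definition frequency (n : nat) : R :=
  match n with
  | 0%nat => 0
  | S m => proj1_sig (frequency_exists m)
  end.

Lemma frequency_phase (n : nat) :
  (1 <= n)%nat -> phase ((-1) ^ n) (frequency n) = (INR n + 1 / 2) * PI.
Proof.
  intros Hn. destruct n as [|m]; [lia|]. unfold frequency.
  destruct (frequency_exists m) as [k [H1 H2]]. simpl proj1_sig. lra.
Qed.

Lemma frequency_interval (n : nat) :
  (1 <= n)%nat -> INR n * PI < frequency n < INR n * PI + PI.
Proof.
  intros Hn. pose proof (frequency_phase n Hn) as Hph.
  pose proof PI_RGT_0 as HPI. pose proof (sign_bound n) as He.
  assert (Hn1 : 1 <= INR n) by (apply (le_INR 1); exact Hn).
  assert (Hk : INR n * PI <= frequency n <= INR n * PI + PI).
  { destruct n as [|m]; [lia|]. unfold frequency.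
    destruct (frequency_exists m) as [k [H1 H2]]. exact H1. }
  pose proof (gudermannian_range (frequency n) ltac:(nra)).
  unfold phase in Hph. set (e := (-1) ^ n) in *. nra.
Qed.

Lemma frequency_pos (n : nat) : (1 <= n)%nat -> 0 < frequency n.
Proof.
  intros Hn. pose proof (frequency_interval n Hn).
  pose proof (Rmult_le_pos _ _ (pos_INR n) (Rlt_le _ _ PI_RGT_0)). lra.
Qed.

Lemma frequency_increasing (m n : nat) : (m < n)%nat -> frequency m < frequency n.
Proof.
  intros Hmn. destruct m as [|m]; [apply frequency_pos; lia|].
  pose proof (frequency_interval (S m) ltac:(lia)) as Hm.
  pose proof (frequency_interval n ltac:(lia)) as Hn.
  assert (INR (S m) + 1 <= INR n) by (rewrite <- S_INR; apply le_INR; lia).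
  pose proof PI_RGT_0. nra.
Qed.

Lemma frequency_unique (n : nat) (k : R) :
  (1 <= n)%nat -> 0 < k -> phase ((-1) ^ n) k = (INR n + 1 / 2) * PI -> k = frequency n.
Proof.
  intros Hn Hk Hph. rewrite <- frequency_phase in Hph by assumption.
  pose proof (frequency_pos n Hn) as Hf. pose proof (sign_bound n) as He.
  destruct (Rtotal_order k (frequency n)) as [Hlt | [Heq | Hgt]]; [|assumption|].
  - pose proof (phase_increasing _ k _ He ltac:(lra) Hlt). lra.
  - pose proof (phase_increasing _ (frequency n) _ He ltac:(lra) Hgt). lra.
Qed.

Lemma cos_cosh_gudermannian (k : R) :
  cos k * cosh k = 1 <-> cos k = cos (gudermannian k).
Proof.
  rewrite cos_gudermannian.
  pose proof (cosh_pos k) as Hc.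
  split; intros H.
  - apply (Rmult_eq_reg_r (cosh k)); [|lra]. rewrite H. field. lra.
  - rewrite H. field. lra.
Qed.

Lemma frequency_root (n : nat) :
  (1 <= n)%nat -> cos (frequency n) * cosh (frequency n) = 1.
Proof.
  intros Hn. apply cos_cosh_gudermannian.
  pose proof (frequency_phase n Hn) as Hph. unfold phase in Hph.
  set (g := gudermannian (frequency n)) in *.
  destruct (Nat.Even_or_Odd n) as [[m Hm] | [m Hm]].
  - assert (E : (-1) ^ n = 1) by (rewrite Hm; apply pow_1_even). rewrite E in Hph.
    replace (frequency n) with (g + 2 * INR m * PI); [apply cos_period|].
    rewrite (f_equal INR Hm), mult_INR in Hph. simpl (INR 2) in Hph. lra.
  - assert (E : (-1) ^ n = -1) by (rewrite Hm, Nat.add_1_r; apply pow_1_odd). rewrite E in Hph.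
    rewrite <- (cos_neg g).
    replace (frequency n) with (- g + 2 * INR (S m) * PI); [apply cos_period|].
    rewrite (f_equal INR Hm), plus_INR, mult_INR in Hph. rewrite S_INR. simpl (INR 2) in Hph. simpl (INR 1) in Hph.
    lra.
Qed.

Lemma root_frequency (k : R) :
  0 < k -> cos k * cosh k = 1 -> exists n, (1 <= n)%nat /\ k = frequency n.
Proof.
  intros Hk Hroot. apply cos_cosh_gudermannian in Hroot.
  pose proof PI_RGT_0 as HPI. pose proof (gudermannian_range k Hk) as Hg.
  assert (Hgk : gudermannian k < k).
  { pose proof (phase_increasing 1 0 k ltac:(lra) ltac:(lra) Hk) as H.
    unfold phase in H. unfold gudermannian at 1 in H.
    rewrite sinh_0, atan_0 in H. lra. }
  set (g := gudermannian k) in *.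
  assert (H : sin ((k - g) / 2) = 0 \/ sin ((k + g) / 2) = 0).
  { assert (E : -2 * sin ((k - g) / 2) * sin ((k + g) / 2) = 0)
      by (rewrite <- form2; lra).
    apply Rmult_integral in E. destruct E as [E|E]; [left | right]; lra. }
  assert (Hint : forall (m : Z), 0 < IZR m * PI -> exists p, IZR m = INR (S p)).
  { intros m Hm. assert (0 < m)%Z by (apply lt_IZR; nra).
    exists (pred (Z.to_nat m)). rewrite Nat.succ_pred by lia.
    rewrite INR_IZR_INZ, Z2Nat.id by lia. reflexivity. }
  destruct H as [H|H]; apply sin_eq_0_0 in H; destruct H as [m Hm];
    (destruct (Hint m) as [p Hp]; [rewrite <- Hm; lra|]); rewrite Hp in Hm.
  - exists (2 * S p)%nat. split; [lia|]. apply frequency_unique; [lia | assumption |].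
    unfold phase. fold g. rewrite pow_1_even, mult_INR. simpl (INR 2). lra.
  - exists (S (2 * p)). split; [lia|]. apply frequency_unique; [lia | assumption |].
    unfold phase. fold g. rewrite pow_1_odd, S_INR, mult_INR. rewrite S_INR in Hm.
    simpl (INR 2). lra.
Qed.

(** * Localization of the roots *)

Lemma atan_le (x : R) : 0 <= x -> atan x <= x.
Proof.
  intros Hx. destruct (Req_dec x 0) as [-> | Hne]; [rewrite atan_0; lra|].
  destruct (mean_value atan (fun y => / (1 + y²)) 0 x) as [c [Hc E]]; [|lra|].
  - intros y. apply is_derive_atan.
  - rewrite atan_0 in E. assert (/ (1 + c²) <= 1).
    { rewrite <- Rinv_1. apply Rinv_le_contravar; [lra|]. pose proof (Rle_0_sqr c). lra. }
    nra.
Qed.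

(** The distance is [PI / 2 - gd k = atan (1 / sinh k)]. *)
Lemma frequency_distance (n : nat) :
  (1 <= n)%nat -> Rabs (frequency n - (INR n + 1 / 2) * PI) <= / sinh (INR n * PI).
Proof.
  intros Hn. pose proof (frequency_phase n Hn) as Hph. unfold phase in Hph.
  pose proof (frequency_interval n Hn) as Hint. pose proof (frequency_pos n Hn) as Hpos.
  assert (0 < INR n * PI)
    by (apply Rmult_lt_0_compat; [apply (lt_INR 0); lia | apply PI_RGT_0]).
  pose proof (sinh_pos _ H) as Hs0. pose proof (sinh_pos _ Hpos) as Hs.
  apply Rle_trans with (/ sinh (frequency n)).
  - apply Rle_trans with (PI / 2 - gudermannian (frequency n)).
    + pose proof (gudermannian_range (frequency n) Hpos).
      destruct (sign_cases n) as [E|E]; rewrite E in Hph.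
      * rewrite Rabs_left; lra.
      * rewrite Rabs_right; lra.
    + unfold gudermannian. rewrite <- atan_inv by assumption.
      apply atan_le, Rlt_le, Rinv_0_lt_compat, Hs.
  - apply Rinv_le_contravar; [assumption|]. apply Rlt_le, sinh_lt. lra.
Qed.

(** For [n = 1] the sign [(-1)^n] puts the root to the right of [3 PI / 2], and the
    later roots are larger. *)
Lemma frequency_ge (n : nat) : (1 <= n)%nat -> 3 / 2 * PI <= frequency n.
Proof.
  intros Hn. assert (H1 : 3 / 2 * PI <= frequency 1).
  { pose proof (frequency_phase 1 ltac:(lia)) as Hph. unfold phase in Hph.
    pose proof (gudermannian_range (frequency 1) (frequency_pos 1 ltac:(lia))).
    simpl INR in Hph. simpl pow in Hph. lra. }
  destruct (Nat.eq_dec n 1) as [-> | Hne]; [exact H1|].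
  pose proof (frequency_increasing 1 n ltac:(lia)). lra.
Qed.

(** * The spectra *)

Lemma sin_eq_0_nat (x : R) : 0 < x -> sin x = 0 -> exists n, (1 <= n)%nat /\ x = INR n * PI.
Proof.
  intros Hx H. apply sin_eq_0_0 in H. destruct H as [m ->]. pose proof PI_RGT_0.
  assert (0 < m)%Z by (apply lt_IZR; nra).
  exists (Z.to_nat m). split; [lia|]. rewrite INR_IZR_INZ, Z2Nat.id by lia. reflexivity.
Qed.

Lemma sin_INR_PI (n : nat) : sin (INR n * PI) = 0.
Proof. rewrite INR_IZR_INZ. apply sin_eq_0_1. exists (Z.of_nat n). reflexivity. Qed.

Lemma INR_PI_increasing (m n : nat) : (m < n)%nat -> INR m * PI < INR n * PI.
Proof. intros H. apply Rmult_lt_compat_r; [apply PI_RGT_0 | apply lt_INR, H]. Qed.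

Lemma navier_spectrum :
  is_eigenvalue_seq 0 2 (shifted_fourth_powers (fun n => INR n * PI) 0).
Proof.
  apply shifted_fourth_powers_spectrum.
  - simpl. ring.
  - apply INR_PI_increasing.
  - intros lam. apply negative_dim. unfold boundary_pairs. simpl. tauto.
  - apply zero_dim_0. lia.
  - intros m Hm. apply navier_dim_1; [|apply sin_INR_PI].
    apply Rmult_lt_0_compat; [apply (lt_INR 0); lia | apply PI_RGT_0].
  - intros x Hx Hno. apply navier_dim_0; [exact Hx|]. intros Hs.
    destruct (sin_eq_0_nat x Hx Hs) as [m [Hm E]]. exact (Hno m Hm E).
Qed.

Lemma kuttler_sigillito_spectrum :
  is_eigenvalue_seq 1 3 (shifted_fourth_powers (fun n => INR n * PI) 1).
Proof.
  apply shifted_fourth_powers_spectrum.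
  - simpl. ring.
  - apply INR_PI_increasing.
  - intros lam. apply negative_dim. unfold boundary_pairs. simpl. tauto.
  - apply zero_dim_1. lia.
  - intros m Hm. apply kuttler_sigillito_dim_1; [|apply sin_INR_PI].
    apply Rmult_lt_0_compat; [apply (lt_INR 0); lia | apply PI_RGT_0].
  - intros x Hx Hno. apply kuttler_sigillito_dim_0; [exact Hx|]. intros Hs.
    destruct (sin_eq_0_nat x Hx Hs) as [m [Hm E]]. exact (Hno m Hm E).
Qed.

(** The four remaining problems share their positive eigenvalues and differ in the
    dimension [p] of the kernel. *)
Lemma clamped_family_spectrum (i j p : nat) :
  clamped_family i j -> has_dim (eigenspace i j 0) p ->
  is_eigenvalue_seq i j (shifted_fourth_powers frequency p).
Proof.
  intros Hij Hp. apply shifted_fourth_powers_spectrum.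
  - reflexivity.
  - apply frequency_increasing.
  - intros lam. apply negative_dim. unfold boundary_pairs. simpl.
    destruct Hij as [[-> ->] | [[-> ->] | [[-> ->] | [-> ->]]]]; tauto.
  - exact Hp.
  - intros m Hm. apply clamped_dim_1; [exact Hij | apply frequency_pos, Hm | apply frequency_root, Hm].
  - intros x Hx Hno. apply clamped_dim_0; [exact Hij | exact Hx |]. intros Hr.
    destruct (root_frequency x Hx Hr) as [m [Hm E]]. exact (Hno m Hm E).
Qed.

(** * Numerical bounds *)

(** Five terms of the series suffice for [exp (1/2)], and [exp 3 = exp (1/2) ^ 6]. *)
Lemma exp_3_ge : 20 <= exp 3.
Proof.
  assert (H : E1 (1 / 2) 4 <= exp (1 / 2)).
  { apply growing_ineq; [|apply E1_cvg]. intros n. unfold E1. rewrite tech5.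
    assert (0 <= / INR (fact (S n)) * (1 / 2) ^ S n); [|lra].
    apply Rmult_le_pos; [|apply pow_le; lra].
    apply Rlt_le, Rinv_0_lt_compat, INR_fact_lt_0. }
  assert (H' : 1648 / 1000 <= exp (1 / 2)).
  { apply Rle_trans with (2 := H). unfold E1. simpl. lra. }
  replace 3 with (1 / 2 + 1 / 2 + 1 / 2 + (1 / 2 + 1 / 2 + 1 / 2)) by lra.
  rewrite !exp_plus. set (e := exp (1 / 2)) in *.
  assert (2715904 / 1000000 <= e * e) by nra.
  assert (4475 / 1000 <= e * e * e) by nra. nra.
Qed.

Lemma PI_ge_3 : 3 <= PI.
Proof. pose proof PI2_3_2. lra. Qed.

(** A Taylor polynomial shows that the cosine is negative at [8/5]. *)
Lemma PI_le_16_5 : PI <= 16 / 5.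
Proof.
  destruct (Rle_lt_dec PI (16 / 5)) as [|Hgt]; [assumption|exfalso].
  pose proof (cos_bound (8 / 5) 0 ltac:(lra) ltac:(lra)) as [_ H].
  assert (0 < cos (8 / 5)) by (apply cos_gt_0; lra).
  unfold cos_approx, cos_term in H. simpl in H. lra.
Qed.

Lemma exp_3n_ge (n : nat) : 20 ^ n <= exp (3 * INR n).
Proof.
  induction n as [|n IH].
  - simpl. rewrite Rmult_0_r, exp_0. lra.
  - replace (3 * INR (S n)) with (3 + 3 * INR n) by (rewrite S_INR; ring).
    rewrite exp_plus. simpl. apply Rmult_le_compat; try lra.
    + apply pow_le. lra.
    + apply exp_3_ge.
Qed.

Lemma sinh_ge (n : nat) : (1 <= n)%nat -> 19 / 40 * 20 ^ n <= sinh (INR n * PI).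
Proof.
  intros Hn. assert (Hn1 : 1 <= INR n) by (apply (le_INR 1); exact Hn).
  pose proof PI_ge_3.
  assert (H1 : 20 ^ n <= exp (INR n * PI)).
  { apply Rle_trans with (1 := exp_3n_ge n).
    destruct (Rle_lt_or_eq_dec (3 * INR n) (INR n * PI)) as [Hlt | ->]; [nra | | lra].
    apply Rlt_le, exp_increasing, Hlt. }
  assert (H2 : exp (- (INR n * PI)) <= 1).
  { rewrite <- exp_0. apply Rlt_le, exp_increasing. nra. }
  assert (H3 : 20 <= 20 ^ n).
  { replace 20 with (20 ^ 1) at 1 by ring. apply Rle_pow; [lra | exact Hn]. }
  unfold sinh. lra.
Qed.

Lemma cube_le_pow2 (n : nat) : (INR n + 1) ^ 3 <= 8 * 2 ^ n.
Proof.
  destruct (Nat.le_gt_cases 3 n) as [Hn | Hn].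
  - induction Hn as [|n Hn IH].
    + simpl. lra.
    + rewrite S_INR. simpl (2 ^ S n). apply le_INR in Hn. simpl (INR 3) in Hn.
      set (m := INR n + 1) in *. assert (4 <= m) by (unfold m; lra).
      apply Rle_trans with (2 * m ^ 3); [|lra]. nra.
  - destruct n as [|[|[|n]]]; [| | |lia]; simpl; lra.
Qed.

(** The binomial formula, read backwards. *)
Lemma c_term_eq (n : nat) :
  c_term n = (INR n + 1 / 2 + PI * exp (- PI * INR n)) ^ 4 - (INR n + 1 / 2) ^ 4.
Proof.
  unfold c_term. set (E := exp (- PI * INR n)).
  replace (exp (- 2 * PI * INR n)) with (E * E) by (unfold E; rewrite <- exp_plus; f_equal; ring).
  replace (exp (- 3 * PI * INR n)) with (E * E * E) by (unfold E; rewrite <- !exp_plus; f_equal; ring).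
  replace (exp (- 4 * PI * INR n)) with (E * E * E * E) by (unfold E; rewrite <- !exp_plus; f_equal; ring).
  ring.
Qed.

(** For [n >= 1] the function [x exp (- n x)] decreases on [x >= 1], so [PI] may be
    replaced by its lower bound 3. *)
Lemma PI_exp_le (n : nat) : (1 <= n)%nat -> PI * exp (- PI * INR n) <= 3 / 20 ^ n.
Proof.
  intros Hn. assert (Hn1 : 1 <= INR n) by (apply (le_INR 1); exact Hn).
  pose proof PI_ge_3. pose proof (exp_3n_ge n) as H20.
  assert (0 < 20 ^ n) by (apply pow_lt; lra).
  replace (- PI * INR n) with (- (3 * INR n + (PI - 3) * INR n)) by ring.
  rewrite exp_Ropp, exp_plus.
  pose proof (exp_ineq1_le ((PI - 3) * INR n)) as He.
  assert (HE : PI / 3 <= exp ((PI - 3) * INR n)) by nra.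
  apply Rmult_le_reg_r with (exp (3 * INR n) * exp ((PI - 3) * INR n)).
  - apply Rmult_lt_0_compat; apply exp_pos.
  - rewrite Rmult_assoc, Rinv_l, Rmult_1_r
      by (apply Rgt_not_eq, Rmult_lt_0_compat; apply exp_pos).
    assert (20 ^ n * (PI / 3) <= exp (3 * INR n) * exp ((PI - 3) * INR n))
      by (apply Rmult_le_compat; lra).
    apply Rle_trans with (3 / 20 ^ n * (20 ^ n * (PI / 3))).
    + right. field. lra.
    + apply Rmult_le_compat_l; [|assumption].
      apply Rlt_le, Rdiv_lt_0_compat; lra.
Qed.

Lemma PI_exp_pos (n : nat) : 0 < PI * exp (- PI * INR n).
Proof. apply Rmult_lt_0_compat; [apply PI_RGT_0 | apply exp_pos]. Qed.

Lemma pow4_diff_le (x y b : R) :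
  0 <= x <= b -> 0 <= y <= b -> Rabs (x ^ 4 - y ^ 4) <= 4 * b ^ 3 * Rabs (x - y).
Proof.
  intros Hx Hy.
  replace (x ^ 4 - y ^ 4) with ((x ^ 3 + x ^ 2 * y + x * y ^ 2 + y ^ 3) * (x - y)) by ring.
  rewrite Rabs_mult. apply Rmult_le_compat_r; [apply Rabs_pos|].
  assert (0 <= x ^ 2 <= b ^ 2) by (split; [apply pow_le | apply pow_incr]; lra).
  assert (0 <= y ^ 2 <= b ^ 2) by (split; [apply pow_le | apply pow_incr]; lra).
  assert (0 <= x ^ 3 <= b ^ 3) by (split; [apply pow_le | apply pow_incr]; lra).
  assert (0 <= y ^ 3 <= b ^ 3) by (split; [apply pow_le | apply pow_incr]; lra).
  assert (0 <= x ^ 2 * y <= b ^ 2 * b)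
    by (split; [apply Rmult_le_pos | apply Rmult_le_compat]; lra).
  assert (0 <= x * y ^ 2 <= b * b ^ 2)
    by (split; [apply Rmult_le_pos | apply Rmult_le_compat]; lra).
  rewrite Rabs_right by lra. replace (b ^ 3) with (b ^ 2 * b) in * by ring. lra.
Qed.

Lemma c_term_bound (n : nat) : (1 <= n)%nat -> 0 <= c_term n <= 96 * (1 / 10) ^ n.
Proof.
  intros Hn. rewrite c_term_eq.
  pose proof (PI_exp_pos n) as Hpos. pose proof (PI_exp_le n Hn) as Hle.
  set (y := PI * exp (- PI * INR n)) in *. pose proof (pos_INR n) as Hn0.
  assert (H20 : 20 <= 20 ^ n).
  { replace 20 with (20 ^ 1) at 1 by ring. apply Rle_pow; [lra | exact Hn]. }
  assert (Hy : y <= 1 / 2).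
  { apply Rle_trans with (1 := Hle). apply Rle_trans with (3 / 20); [|lra].
    unfold Rdiv. apply Rmult_le_compat_l; [lra|]. apply Rinv_le_contravar; lra. }
  split.
  - pose proof (pow_incr (INR n + 1 / 2) (INR n + 1 / 2 + y) 4). lra.
  - apply Rle_trans with (1 := Rle_abs _).
    apply Rle_trans with (4 * (INR n + 1) ^ 3 * Rabs (INR n + 1 / 2 + y - (INR n + 1 / 2))).
    { apply pow4_diff_le; lra. }
    replace (INR n + 1 / 2 + y - (INR n + 1 / 2)) with y by ring.
    rewrite Rabs_right by lra.
    apply Rle_trans with (4 * (8 * 2 ^ n) * (3 / 20 ^ n)).
    + apply Rmult_le_compat; try lra.
      * apply Rmult_le_pos; [lra | apply pow_le; lra].
      * pose proof (cube_le_pow2 n). lra.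
    + right. replace (1 / 10) with (2 * / 20) by lra.
      rewrite Rpow_mult_distr, pow_inv. field. lra.
Qed.

Lemma is_series_geom_tenth (t : R) :
  is_series (fun n => t * (1 / 10) ^ n) (t * (10 / 9)).
Proof.
  replace (10 / 9) with (/ (1 - 1 / 10)) by lra.
  apply (is_series_scal t (fun n => (1 / 10) ^ n)).
  apply is_series_geom. rewrite Rabs_right; lra.
Qed.

Lemma ex_series_c : ex_series (fun n => c_term (S n)).
Proof.
  apply (ex_series_le (K := R_AbsRing) (V := R_CompleteNormedModule))
    with (fun n => (96 / 10) * (1 / 10) ^ n).
  - intros n. pose proof (c_term_bound (S n) ltac:(lia)) as [H1 H2].
    unfold norm; simpl; unfold abs; simpl. rewrite Rabs_right by lra.
    simpl pow in H2. lra.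
  - eexists. apply is_series_geom_tenth.
Qed.

Lemma c_const_split :
  c_const = c_term 1 + c_term 2 + Series (fun n => c_term (S (S (S n)))).
Proof.
  unfold c_const. pose proof ex_series_c as H.
  rewrite Series_incr_1 by exact H.
  rewrite Series_incr_1 by (apply (ex_series_incr_1 (fun n => c_term (S n))); exact H).
  ring.
Qed.

Lemma c_const_lt_3 : c_const < 3.
Proof.
  rewrite c_const_split.
  assert (H1 : c_term 1 <= 235 / 100).
  { rewrite c_term_eq. pose proof (PI_exp_pos 1) as Hpos. pose proof (PI_exp_le 1 ltac:(lia)) as Hle.
    set (y := PI * exp (- PI * INR 1)) in *. simpl (INR 1). replace (3 / 20 ^ 1) with (15 / 100) in Hle by field.
    pose proof (pow_incr (1 + 1 / 2 + y) (165 / 100) 4 ltac:(lra)). lra. }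
  assert (H2 : c_term 2 <= 472 / 1000).
  { rewrite c_term_eq. pose proof (PI_exp_pos 2) as Hpos. pose proof (PI_exp_le 2 ltac:(lia)) as Hle.
    set (y := PI * exp (- PI * INR 2)) in *. simpl (INR 2). replace (3 / 20 ^ 2) with (75 / 10000) in Hle by field.
    pose proof (pow_incr (1 + 1 + 1 / 2 + y) (25075 / 10000) 4 ltac:(lra)). lra. }
  assert (H3 : Series (fun n => c_term (S (S (S n)))) <= 96 / 1000 * (10 / 9)).
  { rewrite <- (is_series_unique _ _ (is_series_geom_tenth (96 / 1000))).
    apply Series_le.
    - intros n. pose proof (c_term_bound (S (S (S n))) ltac:(lia)) as [Ha Hb].
      simpl pow in Hb. lra.
    - eexists. apply is_series_geom_tenth. }
  lra.
Qed.

Lemma exp_neg_16_5_ge : 374 / 10000 <= exp (- (16 / 5)).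
Proof.
  (* Six squarings of [exp (-1/20) >= 95/100]. *)
  assert (sq : forall x a b, a <= exp x -> 0 <= a -> b <= a * a -> b <= exp (x + x)).
  { intros x a b Hx Ha Hb. rewrite exp_plus. nra. }
  pose proof (exp_ineq1_le (- (1 / 20))) as H0.
  pose proof (sq (- (1 / 20)) (95 / 100) (9025 / 10000) ltac:(lra) ltac:(lra) ltac:(lra)) as H1.
  pose proof (sq _ _ (8145 / 10000) H1 ltac:(lra) ltac:(lra)) as H2.
  pose proof (sq _ _ (6634 / 10000) H2 ltac:(lra) ltac:(lra)) as H3.
  pose proof (sq _ _ (44 / 100) H3 ltac:(lra) ltac:(lra)) as H4.
  pose proof (sq _ _ (1936 / 10000) H4 ltac:(lra) ltac:(lra)) as H5.
  pose proof (sq _ _ (374 / 10000) H5 ltac:(lra) ltac:(lra)) as H6.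
  match type of H6 with _ <= exp ?x => replace (- (16 / 5)) with x by lra end.
  exact H6.
Qed.

Lemma c_const_gt_2 : 2 < c_const.
Proof.
  rewrite c_const_split. pose proof PI_ge_3. pose proof PI_le_16_5.
  pose proof exp_neg_16_5_ge as He.
  assert (H1 : 18 / 10 <= c_term 1).
  { rewrite c_term_eq.
    assert (Hy : 1196 / 10000 <= PI * exp (- PI * INR 1)).
    { replace (- PI * INR 1) with (- (16 / 5) + (16 / 5 - PI)) by (simpl; ring).
      rewrite exp_plus. pose proof (exp_ineq1_le (16 / 5 - PI)).
      set (a := exp (- (16 / 5))) in *. set (b := exp (16 / 5 - PI)) in *.
      assert (16 / 5 <= PI * b) by nra. nra. }
    set (y := PI * exp (- PI * INR 1)) in *. simpl (INR 1).
    pose proof (pow_incr (1 + 1 / 2 + 1196 / 10000) (1 + 1 / 2 + y) 4 ltac:(lra)). lra. }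
  assert (H2 : 26 / 100 <= c_term 2).
  { rewrite c_term_eq.
    assert (Hy : 419 / 100000 <= PI * exp (- PI * INR 2)).
    { replace (- PI * INR 2) with ((- (16 / 5) + - (16 / 5)) + 2 * (16 / 5 - PI)) by (simpl; lra).
      rewrite !exp_plus. pose proof (exp_ineq1_le (2 * (16 / 5 - PI))).
      set (a := exp (- (16 / 5))) in *. set (b := exp (2 * (16 / 5 - PI))) in *.
      pose proof (Rmult_le_compat (374 / 10000) a (374 / 10000) a ltac:(lra) ltac:(lra) He He).
      assert (13987 / 10000000 <= a * a * b) by nra. nra. }
    set (y := PI * exp (- PI * INR 2)) in *. simpl (INR 2).
    pose proof (pow_incr (1 + 1 + 1 / 2 + 419 / 100000) (1 + 1 + 1 / 2 + y) 4 ltac:(lra)). lra. }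
  assert (H3 : 0 <= Series (fun n => c_term (S (S (S n))))).
  { apply Rle_trans with (Series (fun n => 0 * (1 / 10) ^ n)).
    - rewrite (is_series_unique _ _ (is_series_geom_tenth 0)). lra.
    - apply Series_le.
      + intros n. pose proof (c_term_bound (S (S (S n))) ltac:(lia)). lra.
      + apply (ex_series_incr_1 (fun n => c_term (S (S n)))).
        apply (ex_series_incr_1 (fun n => c_term (S n))). apply ex_series_c. }
  lra.
Qed.

(** * Riesz means as finite sums *)

Lemma is_series_telescoping (f g : nat -> R) (N : nat) :
  (forall n, (n < N)%nat -> f n = g (S n) - g n) ->
  (forall n, (N <= n)%nat -> f n = 0) ->
  is_series f (g N - g 0%nat).
Proof.
  revert f g. induction N as [|N IH]; intros f g Hf H0.
  - replace (g 0%nat - g 0%nat) with (0 * (10 / 9)) by ring.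
    apply (is_series_ext (fun n => 0 * (1 / 10) ^ n)); [|apply is_series_geom_tenth].
    intros n. rewrite H0 by lia. apply Rmult_0_l.
  - assert (H : is_series (fun n => f (S n)) (g (S N) - g 1%nat)).
    { apply (IH (fun n => f (S n)) (fun n => g (S n))).
      - intros n Hn. apply Hf. lia.
      - intros n Hn. apply H0. lia. }
    replace (g (S N) - g 1%nat) with (g (S N) - g 0%nat + - f 0%nat) in H
      by (rewrite Hf by lia; ring).
    exact (is_series_decr_1 f _ H).
Qed.

Lemma pos_part_of_nonneg (x : R) : 0 <= x -> pos_part x = x.
Proof. intros H. apply Rmax_left, H. Qed.

Lemma pos_part_of_nonpos (x : R) : x <= 0 -> pos_part x = 0.
Proof. intros H. apply Rmax_right, H. Qed.

Lemma pos_part_lipschitz (z x y : R) :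
  Rabs (pos_part (z - x) - pos_part (z - y)) <= Rabs (x - y).
Proof.
  unfold pos_part, Rmax. destruct (Rle_dec (z - x) 0), (Rle_dec (z - y) 0);
    unfold Rabs; repeat destruct Rcase_abs; lra.
Qed.

Lemma riesz_term_ext (L M : nat -> R) (z : R) :
  (forall n, (1 <= n)%nat -> L n = M n) -> forall n, riesz_term L z n = riesz_term M z n.
Proof. intros H n. unfold riesz_term. rewrite H by lia. reflexivity. Qed.

(** The kernel contributes [z] for each of its dimensions. *)
Lemma riesz_shift (k : nat -> R) (z : R) :
  k 0%nat = 0 -> 0 < z -> ex_series (riesz_term (fun n => k n ^ 4) z) ->
  forall p, ex_series (riesz_term (shifted_fourth_powers k p) z) /\
    riesz_mean (shifted_fourth_powers k p) z =
      INR p * z + riesz_mean (fun n => k n ^ 4) z.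
Proof.
  intros k0 Hz Hex p. induction p as [|p [IHex IH]].
  - assert (E : forall n, riesz_term (fun m => k m ^ 4) z n =
                          riesz_term (shifted_fourth_powers k 0) z n) by reflexivity.
    split.
    + exact (ex_series_ext _ _ E Hex).
    + unfold riesz_mean. rewrite (Series_ext _ _ E). simpl. ring.
  - assert (E : forall n, riesz_term (shifted_fourth_powers k p) z n =
                          riesz_term (shifted_fourth_powers k (S p)) z (S n)) by reflexivity.
    assert (E0 : riesz_term (shifted_fourth_powers k (S p)) z 0 = z).
    { unfold riesz_term, shifted_fourth_powers. simpl (1 - S p)%nat. rewrite k0.
      rewrite pos_part_of_nonneg; simpl; lra. }
    assert (Hex' : ex_series (riesz_term (shifted_fourth_powers k (S p)) z)).
    { apply ex_series_incr_1. exact (ex_series_ext _ _ E IHex). }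
    split; [exact Hex'|]. unfold riesz_mean in *.
    rewrite Series_incr_1 by exact Hex'.
    rewrite E0, <- (Series_ext _ _ E), IH, S_INR. ring.
Qed.

(** * Integer points *)

(** Faulhaber's formula for [1^4 + ... + x^4]. *)
Definition sum_pow4 (x : R) : R := x ^ 5 / 5 + x ^ 4 / 2 + x ^ 3 / 3 - x / 30.

Lemma integer_riesz_mean (T : R) (N : nat) :
  0 < T -> INR N <= T < INR N + 1 ->
  is_series (riesz_term (fun n => (INR n * PI) ^ 4) ((PI * T) ^ 4))
    (PI ^ 4 * (INR N * T ^ 4 - sum_pow4 (INR N))).
Proof.
  intros HT HN. pose proof PI_RGT_0 as HPI.
  set (g := fun n => PI ^ 4 * (INR n * T ^ 4 - sum_pow4 (INR n))).
  replace (PI ^ 4 * (INR N * T ^ 4 - sum_pow4 (INR N))) with (g N - g 0%nat)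
    by (unfold g, sum_pow4; simpl; field).
  apply is_series_telescoping.
  - intros n Hn. unfold riesz_term.
    assert (Hle : INR (S n) <= T) by (apply le_INR in Hn; lra).
    pose proof (pos_INR (S n)).
    rewrite pos_part_of_nonneg.
    + unfold g, sum_pow4. rewrite S_INR. field.
    + assert ((INR (S n) * PI) ^ 4 <= (PI * T) ^ 4); [|lra].
      apply pow_incr. split; nra.
  - intros n Hn. unfold riesz_term. apply pos_part_of_nonpos.
    assert (Hle : T <= INR (S n)) by (rewrite S_INR; apply le_INR in Hn; lra).
    assert ((PI * T) ^ 4 <= (INR (S n) * PI) ^ 4); [|lra].
    apply pow_incr. split; nra.
Qed.

(** With [T = n + s] the difference of the two sides is a combination of the
    Bernoulli polynomials in the fractional part [s]. *)
Lemma integer_sum_lower (T n : R) :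
  0 <= n -> n <= T < n + 1 ->
  4 / 5 * T ^ 5 - T ^ 4 / 2 - T ^ 3 / 3 <= n * T ^ 4 - sum_pow4 n.
Proof.
  intros Hn HT. set (s := T - n). assert (Hs : 0 <= s < 1) by (unfold s; lra).
  assert (HsT : s <= T) by (unfold s; lra).
  assert (E : n * T ^ 4 - sum_pow4 n - (4 / 5 * T ^ 5 - T ^ 4 / 2 - T ^ 3 / 3) =
    s * (1 - s) * T * (2 * T * (T - s) + (T - s) + s * s)
    + (T - s) / 30 + s ^ 3 * (s ^ 2 / 5 - s / 2 + 1 / 3)).
  { replace n with (T - s) by (unfold s; ring). unfold sum_pow4. field. }
  assert (0 <= s * (1 - s) * T * (2 * T * (T - s) + (T - s) + s * s)).
  { apply Rmult_le_pos; [apply Rmult_le_pos; nra|].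
    assert (0 <= T * (T - s)) by (apply Rmult_le_pos; lra). nra. }
  assert (0 <= s ^ 3 * (s ^ 2 / 5 - s / 2 + 1 / 3)).
  { apply Rmult_le_pos; [apply pow_le; lra | nra]. }
  lra.
Qed.

Lemma integer_sum_upper (T n : R) :
  n = 0 \/ 1 <= n -> 0 < T -> n <= T < n + 1 ->
  n * T ^ 4 - sum_pow4 n <= 4 / 5 * T ^ 5 - T ^ 4 / 2 + T ^ 3 / 6 + T ^ 2 / 12.
Proof.
  intros [-> | Hn] HT0 HT.
  - unfold sum_pow4.
    assert (E : 4 / 5 * T ^ 5 - T ^ 4 / 2 + T ^ 3 / 6 + T ^ 2 / 12 =
      T ^ 2 * (T * (4 / 5 * (T - 5 / 16) ^ 2 + 17 / 192) + 1 / 12)) by field.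
    assert (0 <= T * (4 / 5 * (T - 5 / 16) ^ 2 + 17 / 192)).
    { apply Rmult_le_pos; [lra|]. pose proof (pow2_ge_0 (T - 5 / 16)). lra. }
    assert (0 <= T ^ 2) by (apply pow2_ge_0). nra.
  - set (y := T - n - 1 / 2). assert (Hy : - (1 / 2) <= y < 1 / 2) by (unfold y; lra).
    assert (HyT : 3 / 2 + y <= T) by (unfold y; lra).
    assert (E : n * T ^ 4 - sum_pow4 n -
        (4 / 5 * T ^ 5 - T ^ 4 / 2 + T ^ 3 / 6 + T ^ 2 / 12) =
      T ^ 2 * (- 2 * (y * y) * T + 2 * y ^ 3 - y / 2 - 1 / 12)
      + T * (1 / 30 - (y ^ 2 - 1 / 4) ^ 2)
      + y * (y ^ 4 / 5 - y ^ 2 / 6 + 7 / 240)).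
    { replace n with (T - y - 1 / 2) by (unfold y; ring). unfold sum_pow4. field. }
    assert (H1 : - 2 * (y * y) * T + 2 * y ^ 3 - y / 2 - 1 / 12 <= - (1 / 16)).
    { assert (0 <= (y * y) * (T - (3 / 2 + y))) by (apply Rmult_le_pos; nra).
      pose proof (pow2_ge_0 (y + 1 / 12)). nra. }
    assert (H2 : T ^ 2 * (- 2 * (y * y) * T + 2 * y ^ 3 - y / 2 - 1 / 12) <= T ^ 2 * - (1 / 16)).
    { apply Rmult_le_compat_l; [apply pow2_ge_0 | exact H1]. }
    assert (H3 : T * (1 / 30 - (y ^ 2 - 1 / 4) ^ 2) <= T * (1 / 30)).
    { apply Rmult_le_compat_l; [lra|]. pose proof (pow2_ge_0 (y ^ 2 - 1 / 4)). lra. }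
    assert (H4 : 0 <= y ^ 4 / 5 - y ^ 2 / 6 + 7 / 240 <= 7 / 240).
    { assert (Hu : 0 <= y ^ 2 <= 1 / 4) by nra.
      replace (y ^ 4) with (y ^ 2 * y ^ 2) by ring. set (u := y ^ 2) in *. nra. }
    nra.
Qed.

Lemma integer_riesz_bounds (T : R) :
  0 < T ->
  PI ^ 4 * (4 / 5 * T ^ 5 - T ^ 4 / 2 - T ^ 3 / 3)
    <= riesz_mean (fun n => (INR n * PI) ^ 4) ((PI * T) ^ 4)
    <= PI ^ 4 * (4 / 5 * T ^ 5 - T ^ 4 / 2 + T ^ 3 / 6 + T ^ 2 / 12).
Proof.
  intros HT. assert (P4 : 0 <= PI ^ 4) by (apply pow_le; pose proof PI_RGT_0; lra).
  destruct (nfloor_ex T ltac:(lra)) as [N HN].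
  unfold riesz_mean. rewrite (is_series_unique _ _ (integer_riesz_mean T N HT HN)).
  split; apply Rmult_le_compat_l; try exact P4.
  - apply integer_sum_lower; [apply pos_INR | exact HN].
  - apply integer_sum_upper; [|exact HT|exact HN].
    destruct N as [|N]; [left; reflexivity | right]. rewrite S_INR. pose proof (pos_INR N). lra.
Qed.

(** * Half-integer points *)

(** Faulhaber's formula for [(1/2)^4 + ... + (x - 1/2)^4]. *)
Definition midpoint_sum_pow4 (x : R) : R := x ^ 5 / 5 - x ^ 3 / 6 + 7 * x / 240.

(** The comparison sequence for the roots of [cos k cosh k = 1]. *)
Definition midpoint (n : nat) : R := (INR n + 1 / 2) * PI.

Lemma midpoint_riesz_mean (T : R) (N : nat) :
  INR N + 1 / 2 <= T < INR N + 3 / 2 ->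
  is_series (riesz_term (fun n => midpoint n ^ 4) ((PI * T) ^ 4))
    (PI ^ 4 * (INR N * T ^ 4 - midpoint_sum_pow4 (INR N + 1) + 1 / 16)).
Proof.
  intros HN. pose proof PI_RGT_0 as HPI. pose proof (pos_INR N) as HN0.
  set (g := fun n => PI ^ 4 * (INR n * T ^ 4 - midpoint_sum_pow4 (INR n + 1))).
  replace (PI ^ 4 * (INR N * T ^ 4 - midpoint_sum_pow4 (INR N + 1) + 1 / 16))
    with (g N - g 0%nat) by (unfold g, midpoint_sum_pow4; simpl (INR 0); field).
  apply is_series_telescoping.
  - intros n Hn. unfold riesz_term, midpoint.
    assert (Hle : INR (S n) + 1 / 2 <= T) by (apply le_INR in Hn; lra).
    pose proof (pos_INR (S n)).
    rewrite pos_part_of_nonneg.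
    + unfold g, midpoint_sum_pow4. rewrite S_INR. field.
    + assert (((INR (S n) + 1 / 2) * PI) ^ 4 <= (PI * T) ^ 4); [|lra].
      apply pow_incr. split; nra.
  - intros n Hn. unfold riesz_term, midpoint. apply pos_part_of_nonpos.
    assert (Hle : T <= INR (S n) + 1 / 2) by (rewrite S_INR; apply le_INR in Hn; lra).
    assert ((PI * T) ^ 4 <= ((INR (S n) + 1 / 2) * PI) ^ 4); [|lra].
    apply pow_incr. split; nra.
Qed.

(** As for the integers, now with [T = n + 1 + y], where [y] is the signed distance
    to the nearest integer.  The term [5/2] leaves room for moving the midpoints to
    the roots. *)
Lemma midpoint_sum_bounds (T n : R) :
  3 / 2 <= T -> n + 1 / 2 <= T < n + 3 / 2 ->
  4 / 5 * T ^ 5 - T ^ 4 - 11 / 6 * T ^ 3 - 3 / 2 * T ^ 2 - 127 / 240 * T + 5 / 2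
    <= n * T ^ 4 - midpoint_sum_pow4 (n + 1) + 1 / 16
    <= 4 / 5 * T ^ 5 - T ^ 4 + T ^ 3 / 6 + 3 / 2 * T ^ 2 + T / 30 + 1 / 8 - 5 / 2.
Proof.
  intros HT0 HT. set (y := T - n - 1). assert (Hy : - (1 / 2) <= y < 1 / 2) by (unfold y; lra).
  assert (E : n * T ^ 4 - midpoint_sum_pow4 (n + 1) + 1 / 16 =
    4 / 5 * T ^ 5 - T ^ 4 + 1 / 16 + T ^ 3 * (1 / 6 - 2 * y ^ 2) + T ^ 2 * (2 * y ^ 3 - y / 2)
    + T * (- y ^ 4 + y ^ 2 / 2 - 7 / 240) + y * (y ^ 4 / 5 - y ^ 2 / 6 + 7 / 240)).
  { replace n with (T - y - 1) by (unfold y; ring). unfold midpoint_sum_pow4. field. }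
  assert (Hu : 0 <= y ^ 2 <= 1 / 4) by nra.
  assert (T3 : 0 <= T ^ 3) by (apply pow_le; lra).
  assert (T2 : 9 / 4 <= T ^ 2) by nra.
  assert (H1 : T ^ 3 * - (1 / 3) <= T ^ 3 * (1 / 6 - 2 * y ^ 2) <= T ^ 3 * (1 / 6))
    by (split; apply Rmult_le_compat_l; lra).
  assert (H2 : T ^ 2 * - (1 / 10) <= T ^ 2 * (2 * y ^ 3 - y / 2) <= T ^ 2 * (1 / 10)).
  { (* Bounds by the tangents near the critical points [y = +-1/sqrt 12]. *)
    assert (0 <= (58 / 100 - y) * (y + 29 / 100) ^ 2)
      by (apply Rmult_le_pos; [lra | apply pow2_ge_0]).
    assert (0 <= (58 / 100 + y) * (y - 29 / 100) ^ 2)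
      by (apply Rmult_le_pos; [lra | apply pow2_ge_0]).
    split; apply Rmult_le_compat_l; lra. }
  assert (H3 : T * - (7 / 240) <= T * (- y ^ 4 + y ^ 2 / 2 - 7 / 240) <= T * (1 / 24)).
  { replace (y ^ 4) with (y ^ 2 * y ^ 2) by ring. set (u := y ^ 2) in *.
    split; apply Rmult_le_compat_l; try lra; nra. }
  assert (H4 : 0 <= y ^ 4 / 5 - y ^ 2 / 6 + 7 / 240 <= 7 / 240).
  { replace (y ^ 4) with (y ^ 2 * y ^ 2) by ring. set (u := y ^ 2) in *. nra. }
  assert (H5 : - (7 / 480) <= y * (y ^ 4 / 5 - y ^ 2 / 6 + 7 / 240) <= 7 / 480) by (split; nra).
  rewrite E. nra.
Qed.

(** * From midpoints to roots *)

(** The error is of order [n^3 exp (- n PI)]; bounding [exp PI] below by 20 and the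
    cubic factor by a multiple of [2^n] leaves a geometric sequence. *)
Lemma frequency_pow4_error (n : nat) :
  (1 <= n)%nat ->
  Rabs (frequency n ^ 4 - midpoint n ^ 4) <= PI ^ 4 * (45 / 2 * (1 / 10) ^ n).
Proof.
  intros Hn. pose proof PI_ge_3 as HPI. pose proof (pos_INR n) as Hn0.
  pose proof (frequency_interval n Hn) as Hint.
  assert (H20 : 0 < 20 ^ n) by (apply pow_lt; lra).
  apply Rle_trans with (4 * ((INR n + 1) * PI) ^ 3 * Rabs (frequency n - midpoint n)).
  { apply pow4_diff_le; [split; [apply Rlt_le, frequency_pos, Hn | lra] | unfold midpoint; split; nra]. }
  apply Rle_trans with (4 * ((8 * 2 ^ n) * PI ^ 3) * (40 / 19 / 20 ^ n)).
  - apply Rmult_le_compat.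
    + apply Rmult_le_pos; [lra|]. apply pow_le. nra.
    + apply Rabs_pos.
    + rewrite Rpow_mult_distr. apply Rmult_le_compat_l; [lra|].
      apply Rmult_le_compat_r; [apply pow_le; lra | apply cube_le_pow2].
    + apply Rle_trans with (1 := frequency_distance n Hn).
      replace (40 / 19 / 20 ^ n) with (/ (19 / 40 * 20 ^ n)) by (field; lra).
      apply Rinv_le_contravar; [lra | apply sinh_ge, Hn].
  - replace (1 / 10) with (2 * / 20) by lra. rewrite Rpow_mult_distr, pow_inv.
    assert (0 < 2 ^ n) by (apply pow_lt; lra).
    replace (4 * (8 * 2 ^ n * PI ^ 3) * (40 / 19 / 20 ^ n))
      with ((1280 / 19) * (PI ^ 3 * (2 ^ n * / 20 ^ n))) by (field; lra).
    replace (PI ^ 4 * (45 / 2 * (2 ^ n * / 20 ^ n)))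
      with ((45 / 2 * PI) * (PI ^ 3 * (2 ^ n * / 20 ^ n))) by ring.
    apply Rmult_le_compat_r; [|lra].
    apply Rmult_le_pos; [apply pow_le; lra|].
    apply Rmult_le_pos; [lra | apply Rlt_le, Rinv_0_lt_compat, H20].
Qed.

Lemma riesz_ex_series (k : nat -> R) (z : R) :
  (forall n, INR n <= k n) -> 0 <= z -> ex_series (riesz_term (fun n => k n ^ 4) z).
Proof.
  intros Hk Hz. destruct (nfloor_ex z Hz) as [N [_ HN]].
  apply (ex_series_incr_n _ (S N)).
  exists (0 * (10 / 9)).
  apply (is_series_ext (fun n => 0 * (1 / 10) ^ n)); [|apply is_series_geom_tenth].
  intros n. unfold riesz_term. rewrite pos_part_of_nonpos; [apply Rmult_0_l|].
  assert (H1 : INR N + 1 <= k (S (S N + n))).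
  { apply Rle_trans with (2 := Hk _). rewrite <- S_INR. apply le_INR. lia. }
  set (x := k (S (S N + n))) in *. pose proof (pos_INR N).
  assert (H2 : x ^ 1 <= x ^ 4) by (apply Rle_pow; [lra | lia]). lra.
Qed.

Lemma frequency_ge_INR (n : nat) : INR n <= frequency n.
Proof.
  destruct n as [|n]; [simpl; lra|].
  pose proof (frequency_interval (S n) ltac:(lia)). pose proof PI_ge_3.
  pose proof (pos_INR (S n)). nra.
Qed.

Lemma riesz_frequency_close (z : R) :
  0 <= z ->
  Rabs (riesz_mean (fun n => frequency n ^ 4) z - riesz_mean (fun n => midpoint n ^ 4) z)
    <= PI ^ 4 * (5 / 2).
Proof.
  intros Hz.
  assert (Hk : ex_series (riesz_term (fun n => frequency n ^ 4) z))
    by (apply riesz_ex_series; [apply frequency_ge_INR | exact Hz]).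
  assert (Hm : ex_series (riesz_term (fun n => midpoint n ^ 4) z)).
  { apply riesz_ex_series; [|exact Hz]. intros n. unfold midpoint.
    pose proof PI_ge_3. pose proof (pos_INR n). nra. }
  assert (Hterm : forall n,
      0 <= Rabs (riesz_term (fun n => frequency n ^ 4) z n - riesz_term (fun n => midpoint n ^ 4) z n)
        <= PI ^ 4 * (9 / 4) * (1 / 10) ^ n).
  { intros n. split; [apply Rabs_pos|].
    apply Rle_trans with (1 := pos_part_lipschitz _ _ _).
    apply Rle_trans with (1 := frequency_pow4_error (S n) ltac:(lia)).
    right. simpl. field. }
  unfold riesz_mean. rewrite <- Series_minus by assumption.
  assert (Hgeom : ex_series (fun n => PI ^ 4 * (9 / 4) * (1 / 10) ^ n))
    by (eexists; apply is_series_geom_tenth).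
  eapply Rle_trans; [apply Series_Rabs|].
  - apply (ex_series_le (K := R_AbsRing) (V := R_CompleteNormedModule)) with (2 := Hgeom).
    intros n. unfold norm; simpl; unfold abs; simpl. rewrite Rabs_Rabsolu. apply Hterm.
  - apply Rle_trans with (Series (fun n => PI ^ 4 * (9 / 4) * (1 / 10) ^ n)).
    + apply Series_le; [exact Hterm | exact Hgeom].
    + rewrite (is_series_unique _ _ (is_series_geom_tenth _)). right. field.
Qed.

(** For [T >= 3/2] the sum over the midpoints is exact up to the total error of
    [riesz_frequency_close]; for smaller [T] the Riesz mean is 0 and the bounds are
    of the right sign. *)
Lemma frequency_riesz_bounds (T : R) :
  0 < T ->
  PI ^ 4 * (4 / 5 * T ^ 5 - T ^ 4 - 11 / 6 * T ^ 3 - 3 / 2 * T ^ 2 - 127 / 240 * T)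
    <= riesz_mean (fun n => frequency n ^ 4) ((PI * T) ^ 4)
    <= PI ^ 4 * (4 / 5 * T ^ 5 - T ^ 4 + T ^ 3 / 6 + 3 / 2 * T ^ 2 + T / 30 + 1 / 8).
Proof.
  intros HT. pose proof PI_ge_3 as HPI.
  assert (P4 : 0 < PI ^ 4) by (apply pow_lt; lra).
  destruct (Rle_lt_dec T (3 / 2)) as [Hle | Hgt].
  - (* No root lies below [PI * T]. *)
    assert (E : riesz_mean (fun n => frequency n ^ 4) ((PI * T) ^ 4) = 0).
    { unfold riesz_mean.
      rewrite (Series_ext _ (fun n => 0 * (1 / 10) ^ n)).
      - rewrite (is_series_unique _ _ (is_series_geom_tenth 0)). ring.
      - intros n. unfold riesz_term. rewrite pos_part_of_nonpos; [ring|].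
        assert ((PI * T) ^ 4 <= frequency (S n) ^ 4); [|lra].
        pose proof (frequency_ge (S n) ltac:(lia)). apply pow_incr. nra. }
    rewrite E.
    assert (T2 : 0 < T ^ 2) by (apply pow_lt; lra).
    split.
    + assert (E' : 4 / 5 * T ^ 5 - T ^ 4 - 11 / 6 * T ^ 3 - 3 / 2 * T ^ 2 - 127 / 240 * T
        = - (T ^ 2 * (T * (1 + T - 4 / 5 * T ^ 2) + 5 / 6 * T + 3 / 2) + 127 / 240 * T)) by field.
      rewrite E'.
      assert (0 <= T * (1 + T - 4 / 5 * T ^ 2)) by (apply Rmult_le_pos; [lra | nra]).
      assert (0 <= T ^ 2 * (T * (1 + T - 4 / 5 * T ^ 2) + 5 / 6 * T + 3 / 2))
        by (apply Rmult_le_pos; lra).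
      nra.
    + assert (E' : 4 / 5 * T ^ 5 - T ^ 4 + T ^ 3 / 6 + 3 / 2 * T ^ 2 + T / 30 + 1 / 8
        = T ^ 2 * (4 / 5 * T ^ 3 - T ^ 2 + T / 6 + 3 / 2) + T / 30 + 1 / 8) by field.
      rewrite E'. apply Rmult_le_pos; [lra|].
      assert (0 <= 4 / 5 * T ^ 3 - T ^ 2 + T / 6 + 3 / 2).
      { assert (0 <= T * (T - 3 / 4) ^ 2) by (apply Rmult_le_pos; [lra | apply pow2_ge_0]). nra. }
      assert (0 <= T ^ 2 * (4 / 5 * T ^ 3 - T ^ 2 + T / 6 + 3 / 2)) by (apply Rmult_le_pos; lra).
      lra.
  - destruct (nfloor_ex (T - 1 / 2) ltac:(lra)) as [N HN].
    pose proof (riesz_frequency_close ((PI * T) ^ 4) ltac:(apply pow_le; nra)) as Hclose.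
    unfold riesz_mean at 2 in Hclose.
    rewrite (is_series_unique _ _ (midpoint_riesz_mean T N ltac:(lra))) in Hclose.
    pose proof (midpoint_sum_bounds T (INR N) ltac:(lra) ltac:(lra)) as [H1 H2].
    apply (Rmult_le_compat_l (PI ^ 4)) in H1; [|lra].
    apply (Rmult_le_compat_l (PI ^ 4)) in H2; [|lra].
    apply Rabs_le_between in Hclose. lra.
Qed.

(** * Conclusion *)

Lemma riesz_mean_of_spectrum (i j : nat) (L k : nat -> R) (p : nat) (z : R) :
  is_eigenvalue_seq i j L -> is_eigenvalue_seq i j (shifted_fourth_powers k p) ->
  k 0%nat = 0 -> (forall n, INR n <= k n) -> 0 < z ->
  ex_series (riesz_term L z) /\
  riesz_mean L z = INR p * z + riesz_mean (fun n => k n ^ 4) z.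
Proof.
  intros HL Hk k0 Hge Hz.
  destruct (riesz_shift k z k0 Hz (riesz_ex_series k z Hge (Rlt_le _ _ Hz)) p) as [Hex Heq].
  pose proof (riesz_term_ext _ _ z (is_eigenvalue_seq_unique i j _ _ HL Hk)) as E.
  split.
  - apply (ex_series_ext (riesz_term (shifted_fourth_powers k p) z)); [|exact Hex].
    intros n. symmetry. apply E.
  - rewrite <- Heq. apply Series_ext, E.
Qed.

Lemma Rpower_pow4_root (w : R) (m : nat) (r : R) :
  0 < w -> r = INR m / 4 -> Rpower (w ^ 4) r = w ^ m.
Proof.
  intros Hw ->. rewrite <- (Rpower_pow 4 w Hw), Rpower_mult, <- Rpower_pow by assumption.
  f_equal. simpl. field.
Qed.

Theorem theorem7p3
  (Lam : nat -> nat -> nat -> R)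
  (HLam : forall i j : nat, In (i, j) boundary_pairs ->
            is_eigenvalue_seq i j (Lam i j)) :
  2 < c_const < 3 /\
  forall z : R, 0 < z ->
        (forall i j : nat, In (i, j) boundary_pairs ->
           ex_series (riesz_term (Lam i j) z)) /\
        (4 / (5 * PI) * Rpower z (5 / 4) - z - 11 * PI / 6 * Rpower z (3 / 4)
          - 3 * PI ^ 2 / 2 * Rpower z (1 / 2)
          - 127 * PI ^ 3 / 240 * Rpower z (1 / 4) - c_const
          <= riesz_mean (Lam 0%nat 1%nat) z
          <= 4 / (5 * PI) * Rpower z (5 / 4) - z + PI / 6 * Rpower z (3 / 4)
          + 3 * PI ^ 2 / 2 * Rpower z (1 / 2)
          + PI ^ 3 / 30 * Rpower z (1 / 4) + PI ^ 4 / 8 + c_const) /\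
        (4 / (5 * PI) * Rpower z (5 / 4) - 1 / 2 * z - PI / 3 * Rpower z (3 / 4)
          <= riesz_mean (Lam 0%nat 2%nat) z
          <= 4 / (5 * PI) * Rpower z (5 / 4) - 1 / 2 * z + PI / 6 * Rpower z (3 / 4)
          + PI ^ 2 / 12 * Rpower z (1 / 2)) /\
        riesz_mean (Lam 0%nat 3%nat) z = riesz_mean (Lam 1%nat 2%nat) z /\
        (4 / (5 * PI) * Rpower z (5 / 4) - 11 * PI / 6 * Rpower z (3 / 4)
          - 3 * PI ^ 2 / 2 * Rpower z (1 / 2)
          - 127 * PI ^ 3 / 240 * Rpower z (1 / 4) - c_const
          <= riesz_mean (Lam 0%nat 3%nat) z
          <= 4 / (5 * PI) * Rpower z (5 / 4) + PI / 6 * Rpower z (3 / 4)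
          + 3 * PI ^ 2 / 2 * Rpower z (1 / 2)
          + PI ^ 3 / 30 * Rpower z (1 / 4) + PI ^ 4 / 8 + c_const) /\
        (4 / (5 * PI) * Rpower z (5 / 4) + 1 / 2 * z - PI / 3 * Rpower z (3 / 4)
          <= riesz_mean (Lam 1%nat 3%nat) z
          <= 4 / (5 * PI) * Rpower z (5 / 4) + 1 / 2 * z + PI / 6 * Rpower z (3 / 4)
          + PI ^ 2 / 12 * Rpower z (1 / 2)) /\
        (4 / (5 * PI) * Rpower z (5 / 4) + z - 11 * PI / 6 * Rpower z (3 / 4)
          - 3 * PI ^ 2 / 2 * Rpower z (1 / 2)
          - 127 * PI ^ 3 / 240 * Rpower z (1 / 4) - c_const
          <= riesz_mean (Lam 2%nat 3%nat) z
          <= 4 / (5 * PI) * Rpower z (5 / 4) + z + PI / 6 * Rpower z (3 / 4)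
          + 3 * PI ^ 2 / 2 * Rpower z (1 / 2)
          + PI ^ 3 / 30 * Rpower z (1 / 4) + PI ^ 4 / 8 + c_const).
Proof.
  pose proof c_const_gt_2 as Hc2. pose proof c_const_lt_3 as Hc3.
  split; [lra|]. intros z Hz.
  assert (intge : forall n, INR n <= INR n * PI)
    by (intros n; pose proof PI_ge_3; pose proof (pos_INR n); nra).
  assert (int0 : INR 0 * PI = 0) by (simpl; ring).
  assert (D01 : is_eigenvalue_seq 0 1 (shifted_fourth_powers frequency 0))
    by (apply clamped_family_spectrum; [unfold clamped_family; tauto | apply zero_dim_0; lia]).
  assert (D03 : is_eigenvalue_seq 0 3 (shifted_fourth_powers frequency 1))
    by (apply clamped_family_spectrum; [unfold clamped_family; tauto | apply zero_dim_1; lia]).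
  assert (D12 : is_eigenvalue_seq 1 2 (shifted_fourth_powers frequency 1))
    by (apply clamped_family_spectrum; [unfold clamped_family; tauto | apply zero_dim_1; lia]).
  assert (D23 : is_eigenvalue_seq 2 3 (shifted_fourth_powers frequency 2))
    by (apply clamped_family_spectrum; [unfold clamped_family; tauto | apply zero_dim_2]).
  assert (H01 : In (0, 1)%nat boundary_pairs) by (unfold boundary_pairs; simpl; tauto).
  assert (H02 : In (0, 2)%nat boundary_pairs) by (unfold boundary_pairs; simpl; tauto).
  assert (H03 : In (0, 3)%nat boundary_pairs) by (unfold boundary_pairs; simpl; tauto).
  assert (H12 : In (1, 2)%nat boundary_pairs) by (unfold boundary_pairs; simpl; tauto).
  assert (H13 : In (1, 3)%nat boundary_pairs) by (unfold boundary_pairs; simpl; tauto).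
  assert (H23 : In (2, 3)%nat boundary_pairs) by (unfold boundary_pairs; simpl; tauto).
  destruct (riesz_mean_of_spectrum _ _ _ _ _ z (HLam _ _ H01) D01 eq_refl frequency_ge_INR Hz) as [X01 R01].
  destruct (riesz_mean_of_spectrum _ _ _ _ _ z (HLam _ _ H03) D03 eq_refl frequency_ge_INR Hz) as [X03 R03].
  destruct (riesz_mean_of_spectrum _ _ _ _ _ z (HLam _ _ H12) D12 eq_refl frequency_ge_INR Hz) as [X12 R12].
  destruct (riesz_mean_of_spectrum _ _ _ _ _ z (HLam _ _ H23) D23 eq_refl frequency_ge_INR Hz) as [X23 R23].
  destruct (riesz_mean_of_spectrum _ _ _ _ _ z (HLam _ _ H02) navier_spectrum int0 intge Hz) as [X02 R02].
  destruct (riesz_mean_of_spectrum _ _ _ _ _ z (HLam _ _ H13) kuttler_sigillito_spectrum int0 intge Hz) as [X13 R13].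
  split.
  { intros i j Hij. unfold boundary_pairs in Hij. simpl In in Hij.
    destruct Hij as [E | [E | [E | [E | [E | [E | []]]]]]]; injection E; intros; subst i j; assumption. }
  rewrite R01, R02, R03, R12, R13, R23. clear - Hz Hc2 Hc3.
  pose proof PI_RGT_0 as HPI.
  destruct (pow4_root z Hz) as [w [Hw ->]].
  set (T := w / PI). assert (Hwt : w = PI * T) by (unfold T; field; lra).
  assert (HT : 0 < T) by (apply Rdiv_lt_0_compat; lra).
  rewrite (Rpower_pow4_root w 5 (5 / 4)) by (simpl; lra).
  rewrite (Rpower_pow4_root w 3 (3 / 4)) by (simpl; lra).
  rewrite (Rpower_pow4_root w 2 (1 / 2)) by (simpl; lra).
  rewrite (Rpower_pow4_root w 1 (1 / 4)) by (simpl; lra).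
  clearbody T. subst w.
  pose proof (frequency_riesz_bounds T HT) as [F1 F2].
  pose proof (integer_riesz_bounds T HT) as [I1 I2].
  assert (E5 : 4 / (5 * PI) * (PI * T) ^ 5 = PI ^ 4 * (4 / 5 * T ^ 5)) by (field; lra).
  rewrite E5. simpl (INR 0). simpl (INR 1). simpl (INR 2).
  repeat split; lra.
Qed.
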